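(* For any $\varepsilon_1,\varepsilon_2$ with $0<\varepsilon_i<1$, $i=1,2$, the $C^*$-algebra $\mathcal{E}(\varepsilon_1)$ is isomorphic to $\mathcal{E}(\varepsilon_2)$.
   Context: Consider the relations (WCAR with two degrees of freedom) $a_i^*a_i+a_ia_i^*=1$ ($i=1,2$), $a_1^*a_2=-a_2a_1^*$. In every irreducible representation of them $a_1a_2+a_2a_1$ is a scalar $y\in\mathbb{C}$ with $|y|\le1$. For $0<\varepsilon<1$, $\mathcal{E}(\varepsilon)$ is the enveloping $C^*$-algebra of these relations together with $a_2a_1+a_1a_2=y$, where $y$ is allowed to take any value with $\varepsilon\le|y|\le1$; i.e. the $C^*$-algebra generated by $a_1,a_2$ universal for those irreducible representations of WCAR in which the scalar $y$ satisfies $\varepsilon\le|y|\le1$. *)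

(* Defs.v *)
From HB Require Import structures.
From mathcomp Require Import all_boot all_order all_algebra sesquilinear.
From mathcomp Require Import all_classical all_reals all_analysis.
From mathcomp Require Export complex.

Set Implicit Arguments.
Unset Strict Implicit.
Unset Printing Implicit Defensive.

Import Order.TTheory GRing.Theory Num.Theory.
Import numFieldNormedType.Exports.

Local Open Scope classical_set_scope.
Local Open Scope ring_scope.
Local Open Scope complex_scope.

(* Norms of normed R[i]-modules take their values in R[i]; being nonnegative,
   these values are real, and z <= t in R[i] means that t - z is a nonnegative
   real number. *)

HB.mixin Record isHilbert (R : realType) H of CompleteNormedModule R[i] H := {
  hdot : {dot H for Num.conj} ;
  hdot_norm : forall u : H, hdot u u = `|u| ^+ 2
}.

#[short(type="hilbertType")]
HB.structure Definition Hilbert (R : realType) :=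
  {H of isHilbert R H & CompleteNormedModule R[i] H}.

(* MathComp has no join of algebras with normed modules, and Hierarchy Builder
   cannot add it after the fact; the multiplication is therefore a field over a
   complete normed module, and the carrier [cstar_sort] is then given both
   canonical structures [algType R[i]] and [completeNormedModType R[i]]. *)
Record cstarAlgType (R : realType) := CStarAlgebra {
  cstar_base : completeNormedModType R[i] ;
  cstar_one : cstar_base ;
  cstar_mul : cstar_base -> cstar_base -> cstar_base ;
  cstar_star : cstar_base -> cstar_base ;
  cstar_mulA : associative cstar_mul ;
  cstar_mul1l : left_id cstar_one cstar_mul ;
  cstar_mul1r : right_id cstar_one cstar_mul ;
  cstar_mulDl : left_distributive cstar_mul +%R ;
  cstar_mulDr : right_distributive cstar_mul +%R ;
  cstar_one_neq0 : cstar_one != 0 ;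
  cstar_scaleAl : forall (c : R[i]) x y,
    c *: cstar_mul x y = cstar_mul (c *: x) y ;
  cstar_scaleAr : forall (c : R[i]) x y,
    c *: cstar_mul x y = cstar_mul x (c *: y) ;
  cstar_starK : involutive cstar_star ;
  cstar_starD : {morph cstar_star : x y / x + y} ;
  cstar_starZ : forall (c : R[i]) x, cstar_star (c *: x) = c^* *: cstar_star x ;
  cstar_starM : forall x y,
    cstar_star (cstar_mul x y) = cstar_mul (cstar_star y) (cstar_star x) ;
  cstar_normM : forall x y, `|cstar_mul x y| <= `|x| * `|y| ;
  cstar_normS : forall x, `|cstar_mul (cstar_star x) x| = `|x| ^+ 2
}.

Definition cstar_sort (R : realType) (A : cstarAlgType R) : Type :=
  cstar_base A.
Coercion cstar_sort : cstarAlgType >-> Sortclass.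

HB.instance Definition _ (R : realType) (A : cstarAlgType R) :=
  CompleteNormedModule.copy (cstar_sort A) (cstar_base A).

HB.instance Definition _ (R : realType) (A : cstarAlgType R) :=
  GRing.Zmodule_isNzRing.Build (cstar_sort A)
    (@cstar_mulA R A) (@cstar_mul1l R A) (@cstar_mul1r R A)
    (@cstar_mulDl R A) (@cstar_mulDr R A) (@cstar_one_neq0 R A).

HB.instance Definition _ (R : realType) (A : cstarAlgType R) :=
  GRing.Lmodule_isLalgebra.Build R[i] (cstar_sort A) (@cstar_scaleAl R A).

HB.instance Definition _ (R : realType) (A : cstarAlgType R) :=
  GRing.Lalgebra_isAlgebra.Build R[i] (cstar_sort A) (@cstar_scaleAr R A).

Definition star (R : realType) (A : cstarAlgType R) (x : A) : A := cstar_star x.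

Definition cstar_isomorphic (R : realType) (E1 E2 : cstarAlgType R) : Prop :=
  exists f : {lrmorphism E1 -> E2},
    bijective f /\ forall x : E1, f (star x) = star (f x).

Definition cstar_generated (R : realType) (E : cstarAlgType R) (G : set E) :
    Prop :=
  forall S : set E,
    closed S -> G `<=` S -> S 1 ->
    (forall x y, S x -> S y -> S (x + y)) ->
    (forall (c : R[i]) x, S x -> S (c *: x)) ->
    (forall x y, S x -> S y -> S (x * y)) ->
    (forall x, S x -> S (star x)) ->
    S = setT.

Definition adjoint_of (R : realType) (H : hilbertType R) (A B : H -> H) : Prop :=
  forall u v : H, hdot (A u) v = hdot u (B v).

Definition closed_subspace (R : realType) (H : hilbertType R) (V : set H) :
    Prop :=
  [/\ closed V, V 0 & forall (c : R[i]) u v, V u -> V v -> V (c *: u + v)].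

(* [S1], [S2] stand for the adjoints of [A1], [A2]. *)
Record wcar_rep (R : realType) (H : hilbertType R)
    (A1 A2 S1 S2 : {linear H -> H}) : Prop := WcarRep {
  wcar_cont1 : continuous A1 ;
  wcar_cont2 : continuous A2 ;
  wcar_adj1 : adjoint_of A1 S1 ;
  wcar_adj2 : adjoint_of A2 S2 ;
  wcar_rel1 : forall v, S1 (A1 v) + A1 (S1 v) = v ;
  wcar_rel2 : forall v, S2 (A2 v) + A2 (S2 v) = v ;
  wcar_rel12 : forall v, S1 (A2 v) = - A2 (S1 v)
}.

Definition irreducible_ops (R : realType) (H : hilbertType R)
    (A1 A2 S1 S2 : {linear H -> H}) : Prop :=
  (exists v : H, v != 0) /\
  forall V : set H, closed_subspace V ->
    (forall v, V v -> [/\ V (A1 v), V (A2 v), V (S1 v) & V (S2 v)]) ->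
    V = [set 0] \/ V = setT.

Definition wcar_irrep (R : realType) (eps : R) (H : hilbertType R)
    (A1 A2 S1 S2 : {linear H -> H}) : Prop :=
  [/\ wcar_rep A1 A2 S1 S2, irreducible_ops A1 A2 S1 S2 &
      exists y : R[i],
        (forall v, A2 (A1 v) + A1 (A2 v) = y *: v) /\ eps%:C <= `|y| <= 1].

Record star_rep (R : realType) (E : cstarAlgType R) (H : hilbertType R)
    (pi : E -> {linear H -> H}) : Prop := StarRep {
  rep_cont : forall x, continuous (pi x) ;
  rep_add : forall x y v, pi (x + y) v = pi x v + pi y v ;
  rep_scale : forall (c : R[i]) x v, pi (c *: x) v = c *: pi x v ;
  rep_mul : forall x y v, pi (x * y) v = pi x (pi y v) ;
  rep_one : forall v, pi 1 v = v ;
  rep_star : forall x, adjoint_of (pi x) (pi (star x))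
}.

(* [E], generated by [a1] and [a2], is the enveloping C*-algebra E(eps): the
   representations in [wcar_irrep eps] extend to [E], and the norm of [E] is
   the enveloping norm |x| = sup_pi |pi x|, where the supremum is over the
   representations pi of [E] which restrict to such a representation, and the
   operator norm |pi x| is the supremum of |pi x v| over |v| <= 1. *)
Record is_wcar_enveloping (R : realType) (eps : R) (E : cstarAlgType R)
    (a1 a2 : E) : Prop := IsWcarEnveloping {
  env_generated : cstar_generated [set a1; a2] ;
  env_extend : forall (H : hilbertType R) (A1 A2 S1 S2 : {linear H -> H}),
    wcar_irrep eps A1 A2 S1 S2 ->
    exists pi : E -> {linear H -> H},
      [/\ star_rep pi, pi a1 =1 A1 & pi a2 =1 A2] ;
  env_norm : forall x : E,
    supremums
      [set r : R[i] | exists (H : hilbertType R) (pi : E -> {linear H -> H}),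
         [/\ star_rep pi,
             wcar_irrep eps (pi a1) (pi a2) (pi (star a1)) (pi (star a2)) &
             exists v : H, `|v| <= 1 /\ r = `|pi x v| ] ]
      `|x|
}.

(* Main.v *)
From HB Require Import structures.
Require Import Defs.
From mathcomp Require Import all_boot all_order all_algebra sesquilinear.
From mathcomp Require Import all_classical all_reals all_analysis.
From mathcomp Require Import ring lra.

(** In an irreducible representation the anticommutators
    alpha = {a1,a1}, delta = {a2,a2}, y = {a1,a2} are scalars, so that a1, a2 and
    their adjoints generate a Clifford algebra whose Gram matrix depends on
    (alpha, delta, y), possibly degenerately.  Write y = |y| w, c1 = w^* a1,
    E = c1 + a2^*, F = c1 - a2^*, p = 1 + |y|, m = {E,E}/2, n = {E,F}/2.  The form on
    the span of E and E^* has determinant s^2 = p^2 - |m|^2 > 0; orthonormalizing it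
    and projecting F off it leaves an element D, anticommuting with E and E^*, with
      {D,D^*} = 2 d,  d = 2 - p (1 + |N|^2),   {D,D} = 2 D1,  D1 = m + m^* N^2,
    where N = n / s.  In the coordinates (w, d, D1, N) the parameter space for
    |y| >= eps is  |D1| <= d,  d + (1 + eps) |N|^2 <= 1 - eps,  so the passage from
    eps1 to eps2 is the linear rescaling of (d, D1) and N by constants k^2 and l, and
    on generators it is D |-> k D with the orthonormal frame of E, E^* kept fixed.
    The new generators are combinations of a1, a2 and their adjoints with scalar
    coefficients obtained from (alpha, delta, y) by algebraic operations, inverses
    and square roots of functions bounded below, hence lie in the C*-algebra.  This
    matches the irreducible representations of the two algebras, and since their
    norms are suprema over these representations, the pairs of elements that agree
    in all matched representations form the graph of an isomorphism. *)

Set Implicit Arguments.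
Unset Strict Implicit.
Unset Printing Implicit Defensive.

Import Order.TTheory GRing.Theory Num.Theory.
Import numFieldNormedType.Exports.

Local Open Scope classical_set_scope.
Local Open Scope ring_scope.
Local Open Scope complex_scope.

Local Notation Re := complex.Re.
Local Notation "x ^*" := (Num.conj x) : complex_scope.

(** * Real-valued norms and completeness *)

Lemma conjCR (R : realType) (x : R) : (x%:C)^* = x%:C :> R[i].
Proof. exact: conjc_real. Qed.

Lemma ReD (R : realType) (x y : R[i]) : Re (x + y) = Re x + Re y.
Proof. by case: x y => [a b] []. Qed.

Section RealNorm.
Variables (R : realType) (V : normedModType R[i]).
Implicit Types u v w : V.

(** The norm itself lives in R[i]; a real-valued copy makes linear arithmetic and suprema over the
    reals available. *)
Definition nrm v : R := Re `|v|.

Lemma nrmE v : `|v| = (nrm v)%:C.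
Proof. by rewrite /nrm RRe_real. Qed.

Lemma nrm_ge0 v : 0 <= nrm v.
Proof. by rewrite -ler0c -nrmE. Qed.

Lemma nrm0 : nrm 0 = 0.
Proof. by rewrite /nrm normr0. Qed.

Lemma nrm_eq0 v : (nrm v == 0) = (v == 0).
Proof. by rewrite -(inj_eq (@complexI R)) -nrmE normr_eq0. Qed.

Lemma nrmN v : nrm (- v) = nrm v.
Proof. by rewrite /nrm normrN. Qed.

Lemma nrmC u v : nrm (u - v) = nrm (v - u).
Proof. by rewrite /nrm distrC. Qed.

Lemma nrmD u v : nrm (u + v) <= nrm u + nrm v.
Proof. by rewrite -lecR rmorphD /= -!nrmE ler_normD. Qed.

Lemma nrmB u v w : nrm (u - w) <= nrm (u - v) + nrm (v - w).
Proof. by rewrite (le_trans _ (nrmD _ _))// addrA subrK. Qed.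

Lemma nrmZ (c : R) v : nrm (c%:C *: v) = `|c| * nrm v.
Proof.
apply: (@complexI R); rewrite -nrmE normrZ rmorphM/= nrmE; congr (_ * _).
by rewrite normc_def /= expr0n addr0 sqrtr_sqr.
Qed.

Lemma nrm_small v : (forall e : R, 0 < e -> nrm v <= e) -> v = 0.
Proof.
move=> h; apply/eqP; rewrite -nrm_eq0 eq_le nrm_ge0 andbT.
by apply/ler_addgt0Pr => e e0; rewrite add0r h.
Qed.

Lemma cvg_nrmP (u : nat -> V) (l : V) :
  u @ \oo --> l <->
  forall e : R, 0 < e -> exists n0, forall n, (n0 <= n)%N -> nrm (u n - l) < e.
Proof.
split=> [/cvgrPdist_lt h e e0|h].
  have [|n0 _ hn] := h e%:C; first by rewrite ltcR.
  by exists n0 => n /hn /=; rewrite nrmE ltcR nrmC.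
apply/cvgrPdist_lt => e e0.
have eE : e = (Re e)%:C by rewrite RRe_real // gtr0_real.
have [|n0 hn] := h (Re e); first by rewrite -ltcR -eE.
by exists n0 => // n /hn /=; rewrite nrmE eE ltcR nrmC.
Qed.

Lemma nrm_cvg_le (u : nat -> V) (l : V) (c : R) :
  u @ \oo --> l -> (forall n, nrm (u n) <= c) -> nrm l <= c.
Proof.
move=> /cvg_nrmP ul uc; apply/ler_addgt0Pr => e /ul[n0 /(_ _ (leqnn n0)) h].
have := nrmB l (u n0) 0; rewrite !subr0 nrmC.
by have := uc n0; lra.
Qed.

End RealNorm.

Lemma lipschitz_continuous (R : realType) (V W : normedModType R[i]) (f : V -> W) (k : R) :
  (forall u v, nrm (f u - f v) <= k * nrm (u - v)) -> continuous f.
Proof.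
move=> fk x; apply/cvgrPdist_lt => e e0.
have eE : e = (Re e)%:C by rewrite RRe_real // gtr0_real.
have k0 : 0 < `|k| + 1 by rewrite ltr_pwDr.
have e0' : 0 < Re e by rewrite -ltcR -eE.
near=> y.
rewrite nrmE eE ltcR (le_lt_trans (fk _ _))//.
have : nrm (x - y) < Re e / (`|k| + 1).
  rewrite -ltcR -nrmE; near: y.
  by apply: cvgr_dist_lt => //; rewrite ltcR divr_gt0.
rewrite ltr_pdivlMr // => h; rewrite (le_lt_trans _ h) // mulrC ler_wpM2l ?nrm_ge0 //.
by rewrite (le_trans (ler_norm k)) // lerDl.
Unshelve. all: by end_near. Qed.

(** Comparison with a bounded real sequence: [t] is nondecreasing because its increments dominate
    norms, and its tail beyond an index close to its supremum bounds the tail of [u]. *)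
Lemma nrm_telescope_cvg (R : realType) (V : completeNormedModType R[i])
    (u : nat -> V) (t : nat -> R) (M : R) :
  (forall n, nrm (u n.+1 - u n) <= t n.+1 - t n) -> (forall n, t n <= M) ->
  exists l : V, u @ \oo --> l.
Proof.
move=> ut tM.
have utm n k : nrm (u (n + k)%N - u n) <= t (n + k)%N - t n.
  elim: k => [|k IH]; first by rewrite addn0 !subrr nrm0.
  rewrite addnS; have := nrmB (u (n + k).+1) (u (n + k)%N) (u n).
  by have := ut (n + k)%N; lra.
have tS : has_sup (range t) by split; [exists (t 0%N), 0%N | exists M => _ [n _ <-]].
suff : cvg (u @ \oo) by move=> h; exists (lim (u @ \oo)).
apply/cauchy_cvgP; apply: cauchy_exP => e e0.
have eE : e = (Re e)%:C by rewrite RRe_real // gtr0_real.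
have e0' : 0 < Re e by rewrite -ltcR -eE.
have [_ [n _ <-] hn] := sup_adherent e0' tS.
exists (u n); exists n => // m /= nm.
rewrite -ball_normE /= nrmE eE ltcR nrmC -(subnKC nm) (le_lt_trans (utm _ _)) //.
have : t (n + (m - n))%N <= sup (range t) by apply: sup_upper_bound => //; exists (n + (m - n))%N.
lra.
Qed.

(** * Schur's lemma *)

Section Hilbert.
Variables (R : realType) (H : hilbertType R).
Implicit Types u v w : H.

Lemma hdotC u v : hdot u v = (hdot v u)^*.
Proof. by rewrite hermC/= expr0 mul1r. Qed.

Lemma hdotZl (c : R[i]) u v : hdot (c *: u) v = c * hdot u v.
Proof. by rewrite linearZl_LR. Qed.

Lemma hdotZr (c : R[i]) u v : hdot u (c *: v) = c^* * hdot u v.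
Proof. by rewrite linearZ. Qed.

Lemma hdotDl u v w : hdot (u + v) w = hdot u w + hdot v w.
Proof. by rewrite linearDl. Qed.

Lemma hdotNl u v : hdot (- u) v = - hdot u v.
Proof. by rewrite linearNl. Qed.

Lemma hdotDr u v w : hdot u (v + w) = hdot u v + hdot u w.
Proof. by rewrite linearD. Qed.

Lemma hdotNr u v : hdot u (- v) = - hdot u v.
Proof. by rewrite linearN. Qed.

Definition hdotlE := (hdotDl, hdotNl, hdotZl).

Lemma nrm_hdot v : hdot v v = (nrm v ^+ 2)%:C.
Proof. by rewrite hdot_norm nrmE rmorphXn. Qed.

Lemma nrm_sqr v : nrm v ^+ 2 = Re (hdot v v).
Proof. by rewrite nrm_hdot. Qed.

Lemma Re_hdotC u v : Re (hdot u v) = Re (hdot v u).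
Proof. by rewrite hdotC; case: (hdot v u). Qed.

Lemma nrm_sqrD u v : nrm (u + v) ^+ 2 = nrm u ^+ 2 + nrm v ^+ 2 + 2 * Re (hdot u v).
Proof.
rewrite !nrm_sqr linearDl linearD /= linearDl /= !raddfD /= (Re_hdotC v u) ; ring.
Qed.

Lemma nrm_sqrB u v : nrm (u - v) ^+ 2 = nrm u ^+ 2 + nrm v ^+ 2 - 2 * Re (hdot u v).
Proof. by rewrite nrm_sqrD nrmN linearN /= raddfN /= mulrN. Qed.

Lemma hdot_ext u v : (forall w, hdot u w = hdot v w) -> u = v.
Proof.
move=> h; apply/subr0_eq/eqP; rewrite -nrm_eq0 -sqrf_eq0 nrm_sqr.
by rewrite linearBl /= h subrr.
Qed.

Lemma adjoint_uniq (A S S' : H -> H) : adjoint_of A S -> adjoint_of A S' -> S =1 S'.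
Proof. by move=> h h' v; apply: hdot_ext => w; rewrite hdotC -h h' -hdotC. Qed.

Lemma adjoint_sym (A S : H -> H) : adjoint_of A S -> adjoint_of S A.
Proof. by move=> h u v; rewrite hdotC -h -hdotC. Qed.

(* |Xv|^2 + |X*v|^2 = 2r|v|^2 and |<X^2 v, v>| <= |Xv||X*v|. *)
Lemma anticommutator_norm_le (X Y : H -> H) (u : R[i]) (r : R) v :
  v != 0 -> adjoint_of X Y -> X (X v) = u *: v ->
  X (Y v) + Y (X v) = (2 * r)%:C *: v -> nrm (u : R[i]^o) <= r.
Proof.
move=> v0 XY Xu XYr.
have nv : 0 < nrm v ^+ 2 by rewrite exprn_gt0 // lt_def nrm_ge0 nrm_eq0 v0.
have e1 : nrm (X v) ^+ 2 + nrm (Y v) ^+ 2 = 2 * r * nrm v ^+ 2.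
  have : Re (hdot v (X (Y v) + Y (X v))) = 2 * r * nrm v ^+ 2.
    by rewrite XYr hdotZr conjCR nrm_hdot /=; ring.
  by rewrite linearD raddfD /= -XY -(adjoint_sym XY) -!nrm_sqr addrC.
have e2 : hdot (X v) (Y v) = u * hdot v v by rewrite -(adjoint_sym (adjoint_sym XY)) Xu hdotZl.
have [u0|u0] := eqVneq u 0.
  rewrite u0 nrm0; move: e1; have := sqr_ge0 (nrm (X v)); have := sqr_ge0 (nrm (Y v)) => *.
  by rewrite -(pmulr_lge0 _ nv); lra.
(* The phase [z] turns u into |u|; expanding |z X v - Y v|^2 >= 0 then bounds |u| itself and not
   only its real part. *)
pose z : R[i] := `|u| / u.
have zu : z * u = `|u| by rewrite divfK.
have zz : z * z^* = 1.
  rewrite -normCK normrM normfV normr_id mulfV ?expr1n // normr_eq0 //.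
have := sqr_ge0 (nrm (z *: X v - Y v)).
rewrite nrm_sqrB hdotZl /= e2 mulrA zu.
have -> : nrm (z *: X v) ^+ 2 = nrm (X v) ^+ 2.
  by rewrite !nrm_sqr hdotZl hdotZr mulrA zz mul1r.
have -> : Re (`|u| * hdot v v) = nrm (u : R[i]^o) * nrm v ^+ 2.
  by rewrite nrm_hdot (nrmE (u : R[i]^o)) -rmorphM.
move=> h; rewrite -(ler_pM2r nv); lra.
Qed.

(** The kernel of T is a closed subspace, invariant under the four operators because T commutes with
    them. *)
Lemma kernel_trivial (A1 A2 S1 S2 : {linear H -> H}) (T : {linear H -> H}) :
  irreducible_ops A1 A2 S1 S2 -> continuous T ->
  (forall v, T (A1 v) = A1 (T v)) -> (forall v, T (A2 v) = A2 (T v)) ->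
  (forall v, T (S1 v) = S1 (T v)) -> (forall v, T (S2 v) = S2 (T v)) ->
  (forall v, T v = 0) \/ (forall v, T v = 0 -> v = 0).
Proof.
move=> [_ irr] Tc c1 c2 c3 c4.
have [||h|h] := irr (T @^-1` [set 0]).
- split=> /=; last first.
  + by move=> c u v /= hu hv; rewrite linearP hu hv scaler0 addr0.
  + by rewrite /= linear0.
  apply: preimage_closed => [x _|]; first exact: Tc.
  by apply: accessible_closed_set1; apply: hausdorff_accessible; exact: norm_hausdorff.
- by move=> v /= hv; rewrite c1 c2 c3 c4 hv !linear0.
- by right=> v hv; have : (T @^-1` [set 0]) v := hv; rewrite h.
- by left=> v; have : (T @^-1` [set 0]) v by rewrite h.
Qed.

(* The limit u solves 2 u = x + u^2, so that 1 - u is a square root of 1 - x. *)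
Fixpoint sqrt_iter (x : H -> H) n v : H :=
  if n is n'.+1 then 2^-1 *: (x v + sqrt_iter x n' (sqrt_iter x n' v)) else 0.

(** The same iteration at the number x = 1. It dominates the norms of the iterates and of their
    increments for every contraction x. *)
Fixpoint sqrt_maj n : R := if n is n'.+1 then (1 + sqrt_maj n' ^+ 2) / 2 else 0.

Lemma sqrt_maj_bound n : 0 <= sqrt_maj n <= 1.
Proof.
elim: n => [|n /= /andP[p0 p1]]; first by rewrite /= lexx ler01.
have p2 : 0 <= sqrt_maj n ^+ 2 <= 1 by rewrite exprn_ge0 // exprn_ile1.
by apply/andP; split; lra.
Qed.

(** * Operator square roots by iteration *)

Section SqrtIter.
Variable x : {linear H -> H}.
Hypothesis x1 : forall v, nrm (x v) <= nrm v.
Local Notation un := (sqrt_iter x).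

Lemma half_real : 2^-1 = (2^-1 : R)%:C.
Proof. by rewrite fmorphV rmorph_nat. Qed.

Lemma sqrt_iter_linear n : linear (un n).
Proof.
elim: n => [|n IH] c a b /=; first by rewrite scaler0 addr0.
rewrite IH IH linearP scalerA mulrC -scalerA -scalerDr; congr (_ *: _).
by rewrite scalerDr addrACA.
Qed.

Lemma sqrt_iterB n a b : un n (a - b) = un n a - un n b.
Proof. by rewrite addrC -scaleN1r sqrt_iter_linear scaleN1r addrC. Qed.

(** The iterates are polynomials in x. *)
Lemma sqrt_iter_comm n (B : {linear H -> H}) :
  (forall v, B (x v) = x (B v)) -> forall v, B (un n v) = un n (B v).
Proof.
by move=> Bx; elim: n => [|n IH] v /=; rewrite ?linear0 // linearZ linearD /= Bx !IH.
Qed.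

Lemma sqrt_iter_le n v : nrm (un n v) <= sqrt_maj n * nrm v.
Proof.
elim: n v => [|n IH] v /=; first by rewrite nrm0 mul0r.
rewrite half_real nrmZ ger0_norm ?invr_ge0 //.
have := nrmD (x v) (un n (un n v)); have := IH (un n v); have := IH v.
have := x1 v; have /andP[p0 _] := sqrt_maj_bound n; have := nrm_ge0 v.
move: (sqrt_maj n) p0 (nrm v) (nrm (x v)) (nrm (un n v)) (nrm (un n (un n v))) (nrm (_ + _)).
move=> p p0 a b c d e a0 ba ca dc eb.
have : p * c <= p * (p * a) by rewrite ler_wpM2l.
rewrite mulrA -expr2; lra.
Qed.

Lemma sqrt_iter_commut n m v : un n (un m v) = un m (un n v).
Proof.
pose B : {linear H -> H} := HB.pack (un n) (GRing.isLinear.Build _ _ _ _ _ (sqrt_iter_linear n)).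
apply: (sqrt_iter_comm m (B := B)) => w /=.
by rewrite (sqrt_iter_comm n (B := x)).
Qed.

(** With a and b two consecutive iterates, the next increment is (a^2 - b^2)/2 = (a + b)(a - b)/2,
    since iterates commute. The majorant obeys the same identity, which carries the induction. *)
Lemma sqrt_iter_step n v :
  nrm (un n.+1 v - un n v) <= (sqrt_maj n.+1 - sqrt_maj n) * nrm v.
Proof.
elim: n v => [|n IH] v.
  rewrite subr0 (le_trans (sqrt_iter_le 1 v)) //= subr0 //.
set a := un n.+1; set b := un n.
have -> : un n.+2 v - a v = 2^-1 *: (a (a v - b v) + b (a v - b v)).
  rewrite [un n.+2 v]/= -/a /a [in LHS]/= -/b -scalerBr /=; congr (_ *: _).
  rewrite opprD addrACA subrr add0r.
  have -> : 2^-1 *: (x v + b (b v)) = a v by [].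
  have -> : 2^-1 *: (x (a v) + b (b (a v))) = a (a v) by [].
  rewrite (_ : 2^-1 *: (x (a v - b v) + b (b (a v - b v))) = a (a v - b v)) //.
  by rewrite /a /b !sqrt_iterB (sqrt_iter_commut n n.+1) addrA subrK.
rewrite half_real nrmZ ger0_norm ?invr_ge0 //.
have := nrmD (a (a v - b v)) (b (a v - b v)).
have := sqrt_iter_le n.+1 (a v - b v); have := sqrt_iter_le n (a v - b v).
rewrite -/a -/b; have := IH v; rewrite -/a -/b.
have /andP[+ _] := sqrt_maj_bound n; have /andP[+ _] := sqrt_maj_bound n.+1; have := nrm_ge0 v.
have -> : sqrt_maj n.+2 - sqrt_maj n.+1 =
    (sqrt_maj n.+1 - sqrt_maj n) * (sqrt_maj n.+1 + sqrt_maj n) / 2.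
  by rewrite [sqrt_maj n.+2]/= [sqrt_maj n.+1 in RHS]/= /=; field.
move: (sqrt_maj _) (sqrt_maj _) (nrm _) (nrm _) (nrm _) (nrm _) (nrm _) => p q r s t z w.
move=> r0 p1 q1 sE tE zE wE.
have : (q + p) * z <= (q + p) * ((q - p) * w) by rewrite ler_wpM2l // addr_ge0.
lra.
Qed.

(** The increments are dominated by those of a bounded majorant, so the iterates converge at every
    vector; linearity, the bound and commutation pass to the limit. For the product of iterates,
    their uniform contractivity is what allows the passage to u (u v). *)
Lemma sqrt_exists : exists u : {linear H -> H},
  [/\ forall v, nrm (u v) <= nrm v,
      forall v, u v + u v = x v + u (u v) &
      forall B : {linear H -> H}, continuous B ->
        (forall v, B (x v) = x (B v)) -> forall v, B (u v) = u (B v)].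
Proof.
have /choice[u uP] : forall v, exists l : H, un ^~ v @ \oo --> l.
  move=> v; apply: (@nrm_telescope_cvg _ _ _ (fun n => sqrt_maj n * nrm v) (nrm v)) => n.
    by rewrite -mulrBl sqrt_iter_step.
  by rewrite ler_piMl ?nrm_ge0 //; have /andP[] := sqrt_maj_bound n.
have hs : hausdorff_space H := @norm_hausdorff _ _.
have ulin : linear u.
  move=> c a b; apply: (cvg_unique _ (uP _)) => //.
  rewrite (_ : un ^~ (c *: a + b) = fun n => c *: un n a + un n b).
    by apply: cvgD => //; apply: cvgZl_tmp.
  by apply/funext => n; rewrite sqrt_iter_linear.
have une n v : nrm (un n v) <= nrm v.
  rewrite (le_trans (sqrt_iter_le n v)) // ler_piMl ?nrm_ge0 //.
  by have /andP[] := sqrt_maj_bound n.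
pose U : {linear H -> H} := HB.pack u (GRing.isLinear.Build _ _ _ _ _ ulin).
exists U; split=> /= [v|v|B Bc Bx v].
- exact: nrm_cvg_le (uP v) (une ^~ v).
- have h2 : (fun n => un n (un n v)) @ \oo --> u (u v).
    apply/cvg_nrmP => e e0.
    have e2 : 0 < e / 2 by rewrite divr_gt0.
    have /cvg_nrmP/(_ _ e2)[n1 h1] := uP v.
    have /cvg_nrmP/(_ _ e2)[n2 h2] := uP (u v).
    exists (maxn n1 n2) => n; rewrite geq_max => /andP[/h1 l1 /h2 l2].
    have := nrmB (un n (un n v)) (un n (u v)) (u (u v)).
    by have := une n (un n v - u v); rewrite sqrt_iterB; lra.
  have h1 : (fun n => 2^-1 *: (x v + un n (un n v))) @ \oo --> 2^-1 *: (x v + u (u v)).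
    by apply: cvgZl_tmp; apply: cvgD => //; apply: cvg_cst.
  have h3 : (fun n => un n.+1 v) @ \oo --> u v.
    by have := uP v; rewrite -(cvg_shiftS (un ^~ v)).
  rewrite {1 2}[u v](cvg_unique hs h3 h1) -scalerDl.
  by rewrite -[2^-1]div1r -splitr scale1r.
- apply: (cvg_unique hs _ (uP (B v))).
  rewrite (_ : un ^~ (B v) = B \o (un ^~ v)); last first.
    by apply/funext => n /=; rewrite sqrt_iter_comm.
  by apply: cvg_comp (uP v) _; exact: Bc.
Qed.

End SqrtIter.

Lemma nrm_linear_continuous (B : {linear H -> H}) (k : R) :
  (forall v, nrm (B v) <= k * nrm v) -> continuous B.
Proof. by move=> h; apply: (@lipschitz_continuous _ _ _ _ k) => u v; rewrite -linearB. Qed.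

Section Schur.
Variables A1 A2 S1 S2 : {linear H -> H}.
Hypothesis irr : irreducible_ops A1 A2 S1 S2.
Hypotheses (A1c : continuous A1) (A2c : continuous A2).
Hypotheses (S1c : continuous S1) (S2c : continuous S2).

Definition commutes_all (Z : H -> H) : Prop :=
  [/\ forall v, Z (A1 v) = A1 (Z v), forall v, Z (A2 v) = A2 (Z v),
      forall v, Z (S1 v) = S1 (Z v) & forall v, Z (S2 v) = S2 (Z v)].

Lemma Re_hdot_adj (Z : H -> H) u v : adjoint_of Z Z -> Re (hdot (Z u) v) = Re (hdot (Z v) u).
Proof. by move=> sa; rewrite sa Re_hdotC. Qed.

(* With u the limit of the square root iteration for 1 - X^2, the product
   (1 - u - X)(1 - u + X) vanishes while both factors commute with the
   irreducible family, so that X = 1 - u or X = u - 1. *)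
Lemma selfadjoint_dichotomy (X : {linear H -> H}) :
  adjoint_of X X -> (forall v, nrm (X v) <= nrm v) -> commutes_all X ->
  (forall v, 0 <= Re (hdot (X v) v)) \/ (forall v, Re (hdot (X v) v) <= 0).
Proof.
move=> sa X1 [c1 c2 c3 c4].
have Xc : continuous X by apply: (@nrm_linear_continuous _ 1) => v; rewrite mul1r.
pose x : {linear H -> H} := idfun \- (X \o X).
have xE v : x v = v - X (X v) by [].
have x1 v : nrm (x v) <= nrm v.
  rewrite -(@ler_pXn2r _ 2) ?nnegrE ?nrm_ge0 // xE nrm_sqrB -sa -nrm_sqr.
  have : nrm (X (X v)) ^+ 2 <= nrm (X v) ^+ 2 by rewrite ler_pXn2r ?nnegrE ?nrm_ge0.
  by have := sqr_ge0 (nrm (X v)); lra.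
have [u [u1 uE uc]] := sqrt_exists x1.
have uX v : X (u v) = u (X v) by apply: uc => // w; rewrite !xE linearB.
have ucont : continuous u by apply: (@nrm_linear_continuous _ 1) => v; rewrite mul1r.
pose T : {linear H -> H} := (idfun \- u) \- X.
have TE v : T v = v - u v - X v by [].
have Tc : continuous T.
  apply: (@nrm_linear_continuous _ 3) => v; rewrite TE.
  have := nrmD (v - u v) (- X v); have := nrmD v (- u v); rewrite !nrmN.
  by have := u1 v; have := X1 v; lra.
have comm (B : {linear H -> H}) : continuous B -> (forall v, X (B v) = B (X v)) ->
    forall v, T (B v) = B (T v).
  move=> Bc XB v; have uB : forall v, B (u v) = u (B v).
    by apply: uc => // w; rewrite !xE linearB !XB.
  by rewrite !TE XB -uB !linearB.
have T0 v : T (v - u v + X v) = 0.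
  have e : u (u v) = u v + u v - v + X (X v) 
    by rewrite uE xE; apply: hdot_ext => w; rewrite !hdotlE; ring.
  rewrite TE !linearD !linearN /= e uX.
  by apply: hdot_ext => w; rewrite linear0l !hdotlE; ring.
have [h|h] := kernel_trivial irr Tc (comm _ A1c c1) (comm _ A2c c2) (comm _ S1c c3) (comm _ S2c c4).
(* Here X = 1 - u with u contractive, so |v - X v| <= |v|; expanding the square gives 2 Re <X v, v>
   >= |X v|^2. The other case is the same with v + X v. *)
- left=> v; have : X v = v - u v by apply/eqP; rewrite eq_sym -subr_eq0 -TE h.
  move=> e; have := nrm_sqrB v (X v); rewrite {1}e opprB addrC subrK Re_hdotC.
  have : nrm (u v) ^+ 2 <= nrm v ^+ 2 by rewrite ler_pXn2r ?nnegrE ?nrm_ge0.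
  by have := sqr_ge0 (nrm (X v)); lra.
- right=> v; have e : v + X v = u v.
    by apply/eqP; rewrite -subr_eq0 addrAC; apply/eqP/h/T0.
  have := nrm_sqrD v (X v); rewrite e Re_hdotC.
  have : nrm (u v) ^+ 2 <= nrm v ^+ 2 by rewrite ler_pXn2r ?nnegrE ?nrm_ge0.
  by have := sqr_ge0 (nrm (X v)); lra.
Qed.

(** By the dichotomy for Z - l, every real l is a lower or an upper bound of the quadratic form of Z
    on unit vectors. The supremum c of the lower bounds is therefore both, and the self-adjoint
    operator Z - c has zero quadratic form, so it vanishes. *)
Lemma schur_selfadjoint (Z : {linear H -> H}) :
  adjoint_of Z Z -> (forall v, nrm (Z v) <= nrm v) -> commutes_all Z ->
  exists c : R, forall v, Z v = c%:C *: v.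
Proof.
move=> sa Z1 [c1 c2 c3 c4].
pose q v := Re (hdot (Z v) v).
have dich l : (forall v, l * nrm v ^+ 2 <= q v) \/ (forall v, q v <= l * nrm v ^+ 2).
  (* The factor [k] makes Z - l a contraction, its norm being at most 1 + |l|. *)
  pose k := (1 + `|l|)^-1.
  have k0 : 0 < k by rewrite invr_gt0 ltr_pwDl.
  pose X : {linear H -> H} := k%:C \*: (Z \- (l%:C \*: idfun)).
  have XE v : X v = k%:C *: (Z v - l%:C *: v) by [].
  have qE v : Re (hdot (X v) v) = k * (q v - l * nrm v ^+ 2).
    rewrite XE hdotZl hdotDl hdotNl hdotZl /= nrm_hdot /q.
    by case: (hdot (Z v) v) => a b /=; ring.
  have comm (B : {linear H -> H}) : (forall v, Z (B v) = B (Z v)) -> forall v, X (B v) = B (X v).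
    by move=> ZB v; rewrite !XE ZB (linearZ_LR B) (linearB B) (linearZ_LR B).
  have [|v||h|h] := @selfadjoint_dichotomy X.
  - move=> u v; rewrite !XE hdotZl hdotDl hdotNl hdotZl (hdotZr k%:C) hdotDr hdotNr (hdotZr l%:C).
    by rewrite !conjCR sa.
  - rewrite XE nrmZ ger0_norm ?(ltW k0) // /k mulrC ler_pdivrMr ?ltr_pwDl //.
    by rewrite (le_trans (nrmD _ _)) // nrmN nrmZ mulrDr mulr1 [nrm v * _]mulrC lerD.
  - by split; apply: comm.
  - by left=> v; have := h v; rewrite qE pmulr_rge0 // subr_ge0.
  - by right=> v; have := h v; rewrite qE pmulr_rle0 // subr_le0.
have qle v : `|q v| <= nrm v ^+ 2.
  have : nrm (Z v) ^+ 2 <= nrm v ^+ 2 by rewrite ler_pXn2r ?nnegrE ?nrm_ge0.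
  have := nrm_sqrD (Z v) v; have := nrm_sqrB (Z v) v; rewrite -/(q v).
  have := sqr_ge0 (nrm (Z v - v)); have := sqr_ge0 (nrm (Z v + v)).
  by rewrite ler_norml => *; apply/andP; split; lra.
have [[w w0] _] := irr.
have w2 : 0 < nrm w ^+ 2 by rewrite exprn_gt0 // lt_def nrm_ge0 nrm_eq0 w0.
pose L := [set l : R | forall v, l * nrm v ^+ 2 <= q v].
have Lsup : has_sup L.
  split; first by exists (-1) => v; have := qle v; rewrite ler_norml => /andP[]; lra.
  exists 1 => l /(_ w); have := qle w; rewrite ler_norml => /andP[_ h] h'.
  by rewrite -(ler_pM2r w2); lra.
pose c := sup L; exists c => v.
have qc v' : q v' = c * nrm v' ^+ 2.
  apply/eqP; rewrite eq_le; apply/andP; split; apply/ler_addgt0Pr => e e0.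
  - have n0 : 0 < nrm v' ^+ 2 + 1 by rewrite ltr_wpDl ?sqr_ge0.
    (* A number above the supremum [c] is no lower bound, hence an upper bound. The denominator
       |v'|^2 + 1 keeps the error at most e and is nonzero even for v' = 0. *)
    have [h|/(_ v')] := dich (c + e / (nrm v' ^+ 2 + 1)).
      have : c + e / (nrm v' ^+ 2 + 1) <= c by apply: sup_upper_bound.
      by rewrite gerDl leNgt divr_gt0.
    rewrite mulrDl => /le_trans; apply; rewrite lerD2l -mulrA ler_piMr ?(ltW e0) //.
    by rewrite mulrC ler_pdivrMr // mul1r lerDl ler01.
  - have n0 : 0 < nrm v' ^+ 2 + 1 by rewrite ltr_wpDl ?sqr_ge0.
    have [//|l Ll hl] := @sup_adherent _ L (e / (nrm v' ^+ 2 + 1)) _ Lsup.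
      by rewrite divr_gt0.
    have : (c - e / (nrm v' ^+ 2 + 1)) * nrm v' ^+ 2 <= q v'.
      by rewrite (le_trans _ (Ll v')) // ler_wpM2r ?sqr_ge0 ?ltW.
    rewrite mulrBl lerBlDr => /le_trans; apply; rewrite lerD2l -mulrA ler_piMr ?(ltW e0) //.
    by rewrite mulrC ler_pdivrMr // mul1r lerDl ler01.
pose W : {linear H -> H} := Z \- (c%:C \*: idfun).
have WE v' : W v' = Z v' - c%:C *: v' by [].
have Wsa : adjoint_of W W.
  by move=> a b; rewrite !WE (hdotDl (Z a)) hdotNl hdotZl hdotDr hdotNr (hdotZr c%:C) conjCR sa.
have W0 v' : Re (hdot (W v') v') = 0.
  rewrite WE hdotDl hdotNl hdotZl /= nrm_hdot.
  by have := qc v'; rewrite /q; case: (hdot (Z v') v') => a b /= ->; ring.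
clearbody W; apply/eqP; rewrite -subr_eq0 -WE -nrm_eq0 -sqrf_eq0; apply/eqP.
(* Polarization: the form of W at v + W v reduces to its two cross terms, each equal to |W v|^2. *)
have := W0 (v + W v); rewrite (linearD W) !hdotDl !hdotDr !ReD !W0.
by rewrite (Re_hdot_adj (W v) v Wsa) -nrm_sqr; lra.
Qed.

End Schur.
End Hilbert.

(** * Change of frame in the Clifford algebra *)

Section Mx4.
Variable K : comNzRingType.

(** Lists of rows let products, transposes and multiples compute to lists again, so that a matrix
    identity splits into sixteen scalar ones. *)
Definition mx4 (s : seq (seq K)) : 'M[K]_4 := \matrix_(i, j) nth 0 (nth [::] s i) j.

Lemma mx4_eq (M N : 'M[K]_4) :
  (forall i j : nat, (i < 4)%N -> (j < 4)%N -> M (inord i) (inord j) = N (inord i) (inord j)) ->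
  M = N.
Proof.
by move=> h; apply/matrixP => k l; rewrite -(inord_val k) -(inord_val l) h.
Qed.

Lemma mx4E s (i j : nat) : (i < 4)%N -> (j < 4)%N ->
  mx4 s (inord i) (inord j) = nth 0 (nth [::] s i) j.
Proof. by move=> hi hj; rewrite mxE !inordK. Qed.

Lemma sum4 (F : 'I_4 -> K) :
  \sum_i F i = F (inord 0) + F (inord 1) + F (inord 2) + F (inord 3).
Proof.
rewrite !big_ord_recl big_ord0 addr0 !addrA.
by congr (F _ + F _ + F _ + F _); apply: val_inj; rewrite /= ?inordK.
Qed.

Lemma mx4_mul s t : mx4 s *m mx4 t =
  mx4 [seq [seq nth 0 r 0 * nth 0 (nth [::] t 0) j + nth 0 r 1 * nth 0 (nth [::] t 1) j
              + nth 0 r 2 * nth 0 (nth [::] t 2) j + nth 0 r 3 * nth 0 (nth [::] t 3) j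
            | j <- iota 0 4] | r <- [seq nth [::] s i | i <- iota 0 4]].
Proof.
apply: mx4_eq => i j hi hj; rewrite mxE sum4 !mx4E //.
by case: i hi => [|[|[|[|i]]]] // _; case: j hj => [|[|[|[|j]]]].
Qed.

Lemma mx4_tr s : (mx4 s)^T =
  mx4 [seq [seq nth 0 (nth [::] s i) j | i <- iota 0 4] | j <- iota 0 4].
Proof.
apply: mx4_eq => i j hi hj; rewrite mxE !mx4E //.
by case: i hi => [|[|[|[|i]]]] // _; case: j hj => [|[|[|[|j]]]].
Qed.

Lemma mx4_scale c s : c *: mx4 s =
  mx4 [seq [seq c * nth 0 (nth [::] s i) j | j <- iota 0 4] | i <- iota 0 4].
Proof.
apply: mx4_eq => i j hi hj; rewrite mxE !mx4E //.
by case: i hi => [|[|[|[|i]]]] // _; case: j hj => [|[|[|[|j]]]].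
Qed.

Lemma mx4_1 : 1%:M = mx4 [:: [:: 1; 0; 0; 0]; [:: 0; 1; 0; 0]; [:: 0; 0; 1; 0]; [:: 0; 0; 0; 1]].
Proof.
apply: mx4_eq => i j hi hj; rewrite mxE !mx4E //.
case: i hi => [|[|[|[|i]]]] // _; case: j hj => [|[|[|[|j]]]] // _;
by rewrite -val_eqE /= !inordK.
Qed.

End Mx4.

Section FrameMatrices.
Variable K : fieldType.
Hypothesis two_neq0 : 2 != 0 :> K.

(* mxK expresses [:: E; F; E^*; F^*] through [:: a1; a2^*; a1^*; a2], and mxF the
   orthogonalized frame through [:: E; F; E^*; F^*]; a trailing b marks the conjugate
   of a variable, and h is the normalizing factor with h^2 = 2 s^2 (p + s). *)
Definition mxK (w wb : K) := mx4
  [:: [:: wb; 1; 0; 0]; [:: wb; -1; 0; 0]; [:: 0; 0; w; 1]; [:: 0; 0; w; -1]].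

Definition mxKinv (w wb : K) := mx4
  [:: [:: w / 2; w / 2; 0; 0]; [:: 1 / 2; - 1 / 2; 0; 0];
      [:: 0; 0; wb / 2; wb / 2]; [:: 0; 0; 1 / 2; - 1 / 2]].

(** Anticommutators of a1, a2^*, a1^*, a2 in this order: the ones and zeros are the WCAR relations
    and their adjoints, the other entries are alpha, delta, y and their conjugates. *)
Definition gramX (al alb de deb y yb : K) := mx4
  [:: [:: al; 0; 1; y]; [:: 0; deb; yb; 1]; [:: 1; yb; alb; 0]; [:: y; 1; 0; de]].

(** Anticommutators of E, F, E^*, F^*. The choice of the phase w makes {E, F^*} vanish, and {F, F^*}
    = 2 - 2 |y| is 2 (2 - p). *)
Definition gramE (p m mb n nb : K) := 2 *: mx4
  [:: [:: m; n; p; 0]; [:: n; m; 0; 2 - p]; [:: p; 0; mb; nb]; [:: 0; 2 - p; nb; mb]].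

(** Anticommutators of the orthogonalized frame: the pair from E and E^* is orthonormal up to the
    factor 2, and D, D^* are decoupled from it. *)
Definition gramD (d D Db : K) := 2 *: mx4
  [:: [:: 0; 0; 1; 0]; [:: 0; D; 0; d]; [:: 1; 0; 0; 0]; [:: 0; d; 0; Db]].

Definition mxF (p s h m mb N Nb : K) := mx4
  [:: [:: (p + s) / h; 0; - m / h; 0]; [:: mb * N / s; 1; - p * N / s; 0];
      [:: - mb / h; 0; (p + s) / h; 0]; [:: - p * Nb / s; 0; m * Nb / s; 1]].

Definition mxB (p s h m mb N Nb : K) := mx4
  [:: [:: s * (p + s) / h; 0; s * m / h; 0];
      [:: - N * mb * s / h; 1; N * s * (p + s) / h; 0];
      [:: s * mb / h; 0; s * (p + s) / h; 0];
      [:: Nb * s * (p + s) / h; 0; - Nb * m * s / h; 1]].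

Lemma mxK_inv w wb : w * wb = 1 -> mxK w wb *m mxKinv w wb = 1%:M.
Proof.
move=> wwb; rewrite mx4_1 mx4_mul /=.
by congr mx4; do ![congr (_ :: _)]; field: wwb.
Qed.

Lemma mxF_inv p s h m mb N Nb :
  m * mb = p ^+ 2 - s ^+ 2 -> h ^+ 2 = 2 * s ^+ 2 * (p + s) -> s != 0 -> h != 0 ->
  mxF p s h m mb N Nb *m mxB p s h m mb N Nb = 1%:M.
Proof.
move=> hm hh s0 h0; rewrite mx4_1 mx4_mul /=.
by congr mx4; do ![congr (_ :: _)]; field: hm hh; rewrite ?s0 ?h0.
Qed.

Lemma mxK_gram w wb m mb n nb p : w * wb = 1 ->
  mxK w wb *m gramX (w ^+ 2 * (m + n)) (wb ^+ 2 * (mb + nb)) (mb - nb) (m - n)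
     ((p - 1) * w) ((p - 1) * wb) *m (mxK w wb)^T = gramE p m mb n nb.
Proof.
move=> wwb; rewrite /gramE mx4_scale mx4_tr !mx4_mul /=.
by congr mx4; do ![congr (_ :: _)]; ring: wwb.
Qed.

Lemma mxF_gram p s h m mb N Nb :
  m * mb = p ^+ 2 - s ^+ 2 -> h ^+ 2 = 2 * s ^+ 2 * (p + s) -> s != 0 -> h != 0 ->
  mxF p s h m mb N Nb *m gramE p m mb (s * N) (s * Nb) *m (mxF p s h m mb N Nb)^T =
  gramD (2 - p * (1 + N * Nb)) (m + mb * N ^+ 2) (mb + m * Nb ^+ 2).
Proof.
move=> hm hh s0 h0; rewrite /gramE /gramD !mx4_scale mx4_tr !mx4_mul /=.
by congr mx4; do ![congr (_ :: _)]; field: hm hh; rewrite ?s0 ?h0.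
Qed.

End FrameMatrices.

(** * Rescaling of the parameters *)

Section Scalars.
Variable R : realType.
Local Notation C := R[i].
Implicit Types (p k l e : R) (m N w z : C).

Definition cabs z : R := Re `|z|.

Lemma cabsE z : `|z| = (cabs z)%:C.
Proof. by rewrite /cabs RRe_real. Qed.

Lemma cabs_sqr z : z * z^* = (cabs z ^+ 2)%:C.
Proof. by rewrite -normCK cabsE rmorphXn. Qed.

Lemma cabs_ge0 z : 0 <= cabs z.
Proof. by rewrite -ler0c -cabsE. Qed.

Lemma cabsM z w : cabs (z * w) = cabs z * cabs w.
Proof. by apply: (@complexI R); rewrite rmorphM /= -!cabsE normrM. Qed.

Lemma cabsV z : cabs z^-1 = (cabs z)^-1.
Proof. by apply: (@complexI R); rewrite fmorphV /= -!cabsE normfV. Qed.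

Lemma cabs_conj z : cabs z^* = cabs z.
Proof. by apply: (@complexI R); rewrite -!cabsE norm_conjC. Qed.

Lemma cabsB z w : cabs (z - w) <= cabs z + cabs w.
Proof. by rewrite -lecR rmorphD /= -!cabsE ler_normB. Qed.

Lemma cabs_real (x : R) : cabs x%:C = `|x|.
Proof. by rewrite /cabs normc_def /= expr0n addr0 sqrtr_sqr. Qed.

Lemma cabs_eq0 z : (cabs z == 0) = (z == 0).
Proof. by rewrite -(inj_eq (@complexI R)) -cabsE normr_eq0. Qed.

Definition dcoef p N : R := 2 - p * (1 + cabs N ^+ 2).
Definition Dcoef m N : C := m + m^* * N ^+ 2.
Definition scoef p m : R := Num.sqrt (p ^+ 2 - cabs m ^+ 2).
(** Normalization of the inverse square root of the matrix A with rows p, m and m^*, p, from the 2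
    by 2 formula sqrt A = (A + sqrt (det A)) / sqrt (tr A + 2 sqrt (det A)) applied to the inverse
    of A; here det A is the square of [scoef]. *)
Definition hcoef p m : R := scoef p m * Num.sqrt (2 * (p + scoef p m)).

(* Solves for (p, m) in terms of the rescaled d, D1 and N. *)
Definition rescale_p k l p N : R := (2 - k * dcoef p N) / (1 + l ^+ 2 * cabs N ^+ 2).
Definition rescale_N l N : C := l%:C * N.

Definition rescale_m k l m N : C :=
  k%:C * (Dcoef m N - rescale_N l N ^+ 2 * (Dcoef m N)^*)
  / (1 - (rescale_N l N * (rescale_N l N)^*) ^+ 2).

(** The constraints that do not mention N. They bound [scoef] away from 0, as is required before N =
    n / s can be used. *)
Definition pre_chart e p m : Prop := 1 + e <= p <= 2 /\ cabs m <= 2 - p.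

(* For p = 1 + |y| these are the constraints eps <= |y| <= 1 and the positivity of
   the forms on the spans of F, F^* and of D, D^*. *)
Definition in_chart e p m N : Prop :=
  [/\ 1 + e <= p <= 2, cabs m <= 2 - p, 0 <= dcoef p N & cabs (Dcoef m N) <= dcoef p N].

Lemma in_chart_pre e p m N : in_chart e p m N -> pre_chart e p m.
Proof. by case. Qed.

(** From d >= 0, (1 + e)(1 + |N|^2) <= p (1 + |N|^2) <= 2. This keeps |N| uniformly below 1. *)
Lemma in_chart_N e p m N : 0 < e -> in_chart e p m N -> cabs N ^+ 2 <= 1 - e.
Proof.
move=> e0 [/andP[p1 p2] _ + _]; rewrite /dcoef.
have : 0 <= cabs N ^+ 2 by rewrite sqr_ge0.
move: (cabs N ^+ 2) => g g0 h.
have : (1 + e) * (1 + g) <= p * (1 + g) by rewrite ler_wpM2r // addr_ge0.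
nra.
Qed.

(** p^2 - |m|^2 >= p^2 - (2 - p)^2 = 4 (p - 1). *)
Lemma pre_chart_s e p m : 0 < e -> pre_chart e p m -> 4 * e <= p ^+ 2 - cabs m ^+ 2.
Proof.
move=> e0 [/andP[p1 p2] mp].
have : cabs m ^+ 2 <= (2 - p) ^+ 2 by rewrite ler_pXn2r ?nnegrE ?cabs_ge0 ?subr_ge0.
nra.
Qed.

Lemma scoef_gt0 e p m : 0 < e -> pre_chart e p m -> 0 < scoef p m.
Proof.
move=> e0 /(pre_chart_s e0) h.
by rewrite sqrtr_gt0 (lt_le_trans _ h) // mulr_gt0.
Qed.

Lemma scoef_sqr e p m : 0 < e -> pre_chart e p m ->
  scoef p m ^+ 2 = p ^+ 2 - cabs m ^+ 2.
Proof.
move=> e0 /(pre_chart_s e0) h.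
by rewrite sqr_sqrtr // (le_trans _ h) // mulr_ge0 // ltW.
Qed.

Lemma hcoef_gt0 e p m : 0 < e -> pre_chart e p m -> 0 < hcoef p m.
Proof.
move=> e0 c; have s0 := scoef_gt0 e0 c; have [/andP[p1 _] _] := c.
by rewrite mulr_gt0 // sqrtr_gt0 mulr_gt0 // addr_gt0 // (lt_le_trans _ p1) // addr_gt0.
Qed.

Lemma hcoef_sqr e p m : 0 < e -> pre_chart e p m ->
  hcoef p m ^+ 2 = 2 * scoef p m ^+ 2 * (p + scoef p m).
Proof.
move=> e0 c; have s0 := scoef_gt0 e0 c; have [/andP[p1 _] _] := c.
have h : 0 <= 2 * (p + scoef p m).
  by rewrite mulr_ge0 // addr_ge0 ?ltW // (lt_le_trans _ p1) // addr_gt0.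
by rewrite exprMn (sqr_sqrtr h); ring.
Qed.

Section Rescale.
Variables (k l : R).

Lemma cabs_rescale_N N : cabs (rescale_N l N) ^+ 2 = l ^+ 2 * cabs N ^+ 2.
Proof. by rewrite cabsM exprMn cabs_real real_normK ?num_real. Qed.

Lemma rescale_dcoef p N :
  dcoef (rescale_p k l p N) (rescale_N l N) = k * dcoef p N.
Proof.
rewrite {1}/dcoef /rescale_p cabs_rescale_N.
rewrite divfK; first by ring.
by rewrite gt_eqF // ltr_pwDl // mulr_ge0 ?sqr_ge0.
Qed.

Lemma rescale_den N : 1 - (rescale_N l N * (rescale_N l N)^*) ^+ 2 =
  (1 - (l ^+ 2 * cabs N ^+ 2) ^+ 2)%:C.
Proof. by rewrite cabs_sqr cabs_rescale_N rmorphB rmorph1 rmorphXn. Qed.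

(** With n the rescaled N, the equation D = m + m^* n^2 and its conjugate form a linear system for m
    and m^* of determinant 1 - |n|^4, nonzero as |n| < 1. *)
Lemma rescale_Dcoef m N : l ^+ 2 * cabs N ^+ 2 < 1 ->
  Dcoef (rescale_m k l m N) (rescale_N l N) = k%:C * Dcoef m N.
Proof.
move=> g1.
have : 1 - (rescale_N l N * (rescale_N l N)^*) ^+ 2 != 0.
  rewrite rescale_den (inj_eq (@complexI R)) subr_eq0 eq_sym.
  by rewrite lt_eqF // expr_lt1 // mulr_ge0 ?sqr_ge0.
rewrite {1}/Dcoef /rescale_m; move: (rescale_N l N) (Dcoef m N) => n D h.
rewrite !(rmorphM, rmorphXn, rmorphB, fmorphV, rmorph1) /= !conjCK conjCR.
by field; apply: contraNN h => /eqP h; apply/eqP; rewrite -h; ring.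
Qed.

End Rescale.

(** The map is linear in d, D1 and N, hence undone by the inverse constants; the bounds on |N|
    before and after rescaling make m recoverable from D1 on both sides. *)
Lemma rescaleK k l p m N : k != 0 -> l != 0 -> cabs N ^+ 2 < 1 ->
  l ^+ 2 * cabs N ^+ 2 < 1 ->
  [/\ rescale_p k^-1 l^-1 (rescale_p k l p N) (rescale_N l N) = p,
      rescale_m k^-1 l^-1 (rescale_m k l m N) (rescale_N l N) = m &
      rescale_N l^-1 (rescale_N l N) = N].
Proof.
move=> k0 l0 g1 g1'.
have NE : rescale_N l^-1 (rescale_N l N) = N.
  by rewrite /rescale_N mulrA -rmorphM mulVf // mul1r.
split=> //.
  rewrite /rescale_p rescale_dcoef mulKf // cabs_rescale_N //.
  rewrite mulrA exprVn mulVf ?sqrf_eq0 // mul1r /dcoef opprB addrCA subrr addr0.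
  by rewrite mulfK // gt_eqF // ltr_pwDl // sqr_ge0.
rewrite /rescale_m NE rescale_Dcoef // fmorphV rmorphM /= conjCR.
have h : 1 - (N * N^*) ^+ 2 != 0.
  have -> : 1 - (N * N^*) ^+ 2 = (1 - (cabs N ^+ 2) ^+ 2)%:C.
    by rewrite cabs_sqr rmorphB rmorph1 [in RHS]rmorphXn.
  rewrite (inj_eq (@complexI R)) subr_eq0 eq_sym.
  by rewrite lt_eqF // expr_lt1 // sqr_ge0.
have k0' : (k%:C : C) != 0 by rewrite (inj_eq (@complexI R)).
rewrite /Dcoef !(rmorphM, rmorphD, rmorphXn) /= conjCK.
by field; rewrite k0' andbT; apply: contraNN h => /eqP h; apply/eqP; rewrite -h; ring.
Qed.

(** The constants are those for which multiplication by k carries d + (1 + e) |N|^2 <= 1 - e to the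
    same constraint for e'. The latter gives p >= 1 + e' for the new p, and d >= 0 gives p <= 2. *)
Lemma in_chart_rescale e e' k l p m N : 0 < e < 1 -> 0 < e' < 1 ->
  k = (1 - e') / (1 - e) -> l ^+ 2 = k * (1 + e) / (1 + e') ->
  in_chart e p m N ->
  in_chart e' (rescale_p k l p N) (rescale_m k l m N) (rescale_N l N).
Proof.
move=> /andP[e0 e1] /andP[e0' e1'] kE lE ch.
have [/andP[p1 p2] mp d0 Dd] := ch.
have k0 : 0 < k by rewrite kE divr_gt0 // subr_gt0.
set d := dcoef p N in d0 Dd *; set g := cabs N ^+ 2.
have g0 : 0 <= g by rewrite sqr_ge0.
have cut : d + (1 + e) * g <= 1 - e.
  have : (1 + e) * (1 + g) <= p * (1 + g) by rewrite ler_wpM2r // addr_ge0.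
  by rewrite /d /dcoef -/g; lra.
have cut' : k * d + (1 + e') * (l ^+ 2 * g) <= 1 - e'.
  have -> : (1 + e') * (l ^+ 2 * g) = k * ((1 + e) * g).
    by rewrite lE; field; rewrite gt_eqF // addr_gt0.
  rewrite -mulrDr (le_trans (ler_wpM2l (ltW k0) cut)) // kE divfK //.
  by rewrite gt_eqF // subr_gt0.
have d0' : 0 <= k * d by rewrite mulr_ge0 // ltW.
have g0' : 0 <= l ^+ 2 * g by rewrite mulr_ge0 ?sqr_ge0.
have eg : 0 <= e' * (l ^+ 2 * g) by rewrite mulr_ge0 // ltW.
have g1' : l ^+ 2 * g < 1 by lra.
have Dp : 0 < 1 + l ^+ 2 * g by rewrite ltr_pwDl.
have p'E : rescale_p k l p N * (1 + l ^+ 2 * g) = 2 - k * d.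
  by rewrite /rescale_p -/d -/g divfK // gt_eqF.
split.
- by apply/andP; split; rewrite -(ler_pM2r Dp) p'E; lra.
(* Put g' = l^2 |N|^2. The new |m| is at most k d / (1 - g') while the new 2 - p is (2 g' + k d) /
   (1 + g'), so the claim reduces to k d <= 1 - g', a consequence of [cut']. *)
- set D := Dcoef m N in Dd.
  have D0 : 0 <= cabs D := cabs_ge0 D.
  have -> : cabs (rescale_m k l m N) =
      k * cabs (D - rescale_N l N ^+ 2 * D^*) / (1 - (l ^+ 2 * g) ^+ 2).
    rewrite /rescale_m rescale_den -/D -/g !cabsM cabsV !cabs_real !ger0_norm ?ltW //.
    by rewrite subr_gt0 expr_lt1.
  have h1 : cabs (D - rescale_N l N ^+ 2 * D^*) <= cabs D * (1 + l ^+ 2 * g).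
    rewrite (le_trans (cabsB _ _)) // cabsM cabs_conj mulrDr mulr1 lerD2l mulrC.
    by rewrite expr2 cabsM -expr2 cabs_rescale_N.
  have h2 : 0 < 1 - l ^+ 2 * g by rewrite subr_gt0.
  rewrite -(ler_pM2r Dp) mulrBl p'E.
  have -> : 1 - (l ^+ 2 * g) ^+ 2 = (1 - l ^+ 2 * g) * (1 + l ^+ 2 * g) by ring.
  rewrite invfM mulrA mulfVK ?gt_eqF // ler_pdivrMr //.
  have : k * cabs (D - rescale_N l N ^+ 2 * D^*) <= k * d * (1 + l ^+ 2 * g).
    rewrite -mulrA ler_wpM2l ?(ltW k0) // (le_trans h1) // ler_wpM2r // ltW //.
  have : (k * d) * (l ^+ 2 * g) <= (1 - l ^+ 2 * g) * (l ^+ 2 * g).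
    by rewrite ler_wpM2r //; lra.
  by lra.
- by rewrite rescale_dcoef.
- rewrite rescale_dcoef rescale_Dcoef // cabsM cabs_real ger0_norm ?(ltW k0) //.
  by rewrite ler_wpM2l ?(ltW k0).
Qed.

End Scalars.

(** * The chart on parameter triples and the matrix changing the generators *)

Section Rescaling.
Variable R : realType.
Local Notation C := R[i].
Local Notation param := (C * C * C)%type.
Implicit Types (T : param) (p k l e : R) (m N w : C).

(* A parameter T is the triple (alpha, delta, y). *)
Definition cw T : C := T.2 / (cabs T.2)%:C.
Definition cp T : R := 1 + cabs T.2.
Definition cm T : C := ((cw T)^* ^+ 2 * T.1.1 + (T.1.2)^*) / 2.
Definition cn T : C := ((cw T)^* ^+ 2 * T.1.1 - (T.1.2)^*) / 2.
Definition cN T : C := cn T / (scoef (cp T) (cm T))%:C.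

Definition in_param e T : Prop := in_chart e (cp T) (cm T) (cN T).

Definition unchart w p m N : param :=
  (w ^+ 2 * (m + (scoef p m)%:C * N), (m - (scoef p m)%:C * N)^*, (p - 1)%:C * w).

Lemma cw_unit T : T.2 != 0 -> cw T * (cw T)^* = 1.
Proof.
move=> y0; rewrite /cw rmorphM fmorphV /= conjCR mulrACA cabs_sqr rmorphXn /=.
by rewrite -expr2 exprVn mulfV // sqrf_eq0 (inj_eq (@complexI R)) cabs_eq0.
Qed.

Lemma in_param_neq0 e T : 0 < e -> in_param e T -> T.2 != 0.
Proof.
move=> e0 [/andP[+ _] _ _ _]; rewrite /cp lerD2l => h.
by rewrite -cabs_eq0 gt_eqF // (lt_le_trans e0).
Qed.

Lemma param_chart T : T.2 != 0 -> T =
  (cw T ^+ 2 * (cm T + cn T), (cm T - cn T)^*, (cp T - 1)%:C * cw T).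
Proof.
move=> y0; have w1 := cw_unit y0.
rewrite /cm /cn /cp addrAC subrr add0r.
have -> : (cabs T.2)%:C * cw T = T.2.
  by rewrite /cw mulrC divfK // (inj_eq (@complexI R)) cabs_eq0.
case: T {y0} w1 => [[al de] y] /=; move: (cw _) => w w1.
congr (_, _, _).
  by field: w1.
have -> : (w^* ^+ 2 * al + de^*) / 2 - (w^* ^+ 2 * al - de^*) / 2 = de^* by field.
by rewrite conjCK.
Qed.

Lemma scoef_cN e T : 0 < e -> pre_chart e (cp T) (cm T) ->
  (scoef (cp T) (cm T))%:C * cN T = cn T.
Proof.
move=> e0 ch; rewrite /cN mulrC divfK // (inj_eq (@complexI R)) gt_eqF //.
exact: scoef_gt0 e0 ch.
Qed.

Lemma unchartK e T : 0 < e -> in_param e T ->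
  unchart (cw T) (cp T) (cm T) (cN T) = T.
Proof.
move=> e0 ch; rewrite [RHS](param_chart (in_param_neq0 e0 ch)) /unchart.
by rewrite (scoef_cN e0 (in_chart_pre ch)).
Qed.

Lemma cabs1 w : w * w^* = 1 -> cabs w = 1.
Proof.
move=> w1; apply/eqP; rewrite -(@eqrXn2 _ 2) ?cabs_ge0 // expr1n.
by rewrite -(inj_eq (@complexI R)) -cabs_sqr w1.
Qed.

Section ChartUnchart.
Variables (e : R) (w : C) (p : R) (m N : C).
Hypotheses (e0 : 0 < e) (w1 : w * w^* = 1) (ch : in_chart e p m N).
Local Notation T := (unchart w p m N).

Let p1 : 0 < p - 1.
Proof. by have [/andP[h _] _ _ _] := ch; rewrite subr_gt0 (lt_le_trans _ h) // ltrDl. Qed.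

Lemma cabs_unchart : cabs T.2 = p - 1.
Proof. by rewrite /= cabsM cabs_real (cabs1 w1) mulr1 ger0_norm // ltW. Qed.

Lemma cp_unchart : cp T = p.
Proof. by rewrite /cp cabs_unchart addrC subrK. Qed.

Lemma cw_unchart : cw T = w.
Proof.
by rewrite /cw cabs_unchart /= mulrAC mulfV ?mul1r // (inj_eq (@complexI R)) gt_eqF.
Qed.

Lemma cm_unchart : cm T = m.
Proof.
by rewrite /cm cw_unchart /= conjCK; field: w1.
Qed.

Lemma cN_unchart : cN T = N.
Proof.
have s0 : (scoef p m)%:C != 0 :> C.
  by rewrite (inj_eq (@complexI R)) gt_eqF // (scoef_gt0 e0 (in_chart_pre ch)).
rewrite /cN /cn cm_unchart cp_unchart cw_unchart /= conjCK.
by field: w1; rewrite s0.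
Qed.

End ChartUnchart.

Definition resc k l T : param :=
  unchart (cw T) (rescale_p k l (cp T) (cN T)) (rescale_m k l (cm T) (cN T))
    (rescale_N l (cN T)).

Definition gram T : 'M[C]_4 :=
  gramX T.1.1 (T.1.1)^* T.1.2 (T.1.2)^* T.2 (T.2)^*.

Definition frame p m N : 'M[C]_4 :=
  mxF p%:C (scoef p m)%:C (hcoef p m)%:C m m^* N N^*.

Definition coframe p m N : 'M[C]_4 :=
  mxB p%:C (scoef p m)%:C (hcoef p m)%:C m m^* N N^*.

Definition mxS (k : C) : 'M[C]_4 :=
  mx4 [:: [:: 1; 0; 0; 0]; [:: 0; k; 0; 0]; [:: 0; 0; 1; 0]; [:: 0; 0; 0; k]].

Lemma mxS_inv (k : C) : k != 0 -> mxS k^-1 *m mxS k = 1%:M.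
Proof.
by move=> k0; rewrite mx4_1 mx4_mul /=; congr mx4; do ![congr (_ :: _)]; field.
Qed.

Lemma mxS_gram (k d D Db : C) :
  mxS k *m gramD d D Db *m (mxS k)^T = gramD (k ^+ 2 * d) (k ^+ 2 * D) (k ^+ 2 * Db).
Proof.
rewrite /gramD !mx4_scale mx4_tr !mx4_mul /=.
by congr mx4; do ![congr (_ :: _)]; ring.
Qed.

Section Frame.
Variables (e p : R) (m N : C).
Hypotheses (e0 : 0 < e) (ch : pre_chart e p m).

Let rels : [/\ m * m^* = p%:C ^+ 2 - (scoef p m)%:C ^+ 2,
  (hcoef p m)%:C ^+ 2 = 2 * (scoef p m)%:C ^+ 2 * (p%:C + (scoef p m)%:C),
  (scoef p m)%:C != 0 :> C & (hcoef p m)%:C != 0 :> C].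
Proof.
split.
- by rewrite cabs_sqr -!rmorphXn -rmorphB /= (scoef_sqr e0 ch) opprB addrC subrK.
- by rewrite -!rmorphXn /= (hcoef_sqr e0 ch) !rmorphM rmorph_nat rmorphD.
- by rewrite (inj_eq (@complexI R)) gt_eqF // (scoef_gt0 e0 ch).
- by rewrite (inj_eq (@complexI R)) gt_eqF // (hcoef_gt0 e0 ch).
Qed.

Lemma frameK : frame p m N *m coframe p m N = 1%:M.
Proof. by have [h1 h2 h3 h4] := rels; exact: mxF_inv. Qed.

Lemma coframeK : coframe p m N *m frame p m N = 1%:M.
Proof. by apply: mulmx1C; exact: frameK. Qed.

Lemma frame_gram :
  frame p m N *m gramE p%:C m m^* ((scoef p m)%:C * N) ((scoef p m)%:C * N^*)
    *m (frame p m N)^T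
  = gramD (dcoef p N)%:C (Dcoef m N) (Dcoef m N)^*.
Proof.
have [h1 h2 h3 h4] := rels; rewrite mxF_gram //; congr gramD.
  by rewrite cabs_sqr [RHS]rmorphB rmorph_nat (rmorphM _ p) (rmorphD _ 1 (cabs N ^+ 2)) rmorph1.
by rewrite /Dcoef rmorphD rmorphM rmorphXn /= conjCK.
Qed.

End Frame.

Lemma two_neq0 : 2 != 0 :> C.
Proof. by rewrite pnatr_eq0. Qed.

Lemma gramX_chart w p m n : w * w^* = 1 ->
  mxK w w^* *m gram (w ^+ 2 * (m + n), (m - n)^*, (p - 1)%:C * w) *m (mxK w w^*)^T =
  gramE p%:C m m^* n n^*.
Proof.
move=> w1; rewrite -[RHS](mxK_gram _ _ _ _ _ w1); congr (_ *m _ *m _).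
rewrite /gram /=; congr gramX; rewrite ?conjCK //.
- by rewrite rmorphM rmorphXn rmorphD.
- by rewrite rmorphB.
- by rewrite rmorphB rmorph1.
- by rewrite rmorphM /= conjCR rmorphB rmorph1.
Qed.

Lemma gram_unchart w p m N : w * w^* = 1 ->
  mxK w w^* *m gram (unchart w p m N) *m (mxK w w^*)^T =
  gramE p%:C m m^* ((scoef p m)%:C * N) ((scoef p m)%:C * N^*).
Proof. by move=> w1; rewrite gramX_chart // rmorphM /= conjCR. Qed.

(* Entries 2, 3 of the 4-vectors of operators are the adjoints of entries 0, 1. *)
Definition tau (i : 'I_4) : 'I_4 := inord ((i + 2) %% 4).

(** The condition under which applying M to a 4-vector of operators keeps entries i and [tau i]
    adjoint to each other. *)
Definition tau_real (M : 'M[C]_4) : Prop := forall i j, M (tau i) (tau j) = (M i j)^*.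

Lemma tauK : involutive tau.
Proof.
by move=> i; apply: val_inj; case: i => [[|[|[|[|i]]]] hi] //=; rewrite !inordK.
Qed.

Lemma tau_realM (M N : 'M[C]_4) : tau_real M -> tau_real N -> tau_real (M *m N).
Proof.
move=> hM hN i j; rewrite !mxE rmorph_sum /= (reindex_inj (inv_inj tauK)) /=.
by apply: eq_bigr => l _; rewrite hM hN rmorphM.
Qed.

Lemma tau_real_mx4 s :
  (forall i j : nat, (i < 4)%N -> (j < 4)%N ->
    nth 0 (nth [::] s ((i + 2) %% 4)) ((j + 2) %% 4) = (nth 0 (nth [::] s i) j)^*) ->
  tau_real (mx4 s).
Proof. by move=> h i j; rewrite !mxE /= !inordK ?ltn_pmod // h. Qed.

(** From right to left: pass to E, F, E^*, F^*, orthogonalize for T, scale D by k, undo the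
    orthogonalization for the rescaled parameter, return to the generators. Since d and D1 are
    quadratic in D, their constant is k^2. *)
Definition Lmx (k l : R) T : 'M[C]_4 :=
  mxKinv (cw T) (cw T)^* *m
  (coframe (rescale_p (k ^+ 2) l (cp T) (cN T)) (rescale_m (k ^+ 2) l (cm T) (cN T))
     (rescale_N l (cN T)) *m
   (mxS k%:C *m (frame (cp T) (cm T) (cN T) *m mxK (cw T) (cw T)^*))).

Lemma frame_change_inv (n : nat) (Ki K G0 F0 G1 F1 S S' : 'M[C]_n) :
  K *m Ki = 1%:M -> G0 *m F0 = 1%:M -> F1 *m G1 = 1%:M -> S' *m S = 1%:M ->
  (Ki *m (G0 *m (S' *m (F1 *m K)))) *m (Ki *m (G1 *m (S *m (F0 *m K)))) = 1%:M.
Proof.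
move=> hK h0 h1 hS; rewrite -!mulmxA (mulmxA K) hK mul1mx (mulmxA F1) h1 mul1mx.
by rewrite (mulmxA S') hS mul1mx (mulmxA G0) h0 mul1mx; apply: mulmx1C.
Qed.

(** Q is carried to the orthogonal form D' through K, F0 and S, and Q' to the same form through K
    and F1; as K and F1 are invertible, the composite carries Q to Q'. *)
Lemma frame_change_gram (n : nat) (Ki K F0 G1 F1 S Q Q' D D' E E' : 'M[C]_n) :
  K *m Ki = 1%:M -> F1 *m G1 = 1%:M ->
  K *m Q *m K^T = E -> F0 *m E *m F0^T = D -> S *m D *m S^T = D' ->
  F1 *m E' *m F1^T = D' -> K *m Q' *m K^T = E' ->
  (Ki *m (G1 *m (S *m (F0 *m K)))) *m Q *m (Ki *m (G1 *m (S *m (F0 *m K))))^T = Q'.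
Proof.
move=> hK hF hE hD hS hD' hE'.
have hK' := mulmx1C hK; have hF' := mulmx1C hF.
have cancel (A B X : 'M[C]_n) : A *m B = 1%:M -> A *m (B *m X *m B^T) *m A^T = X.
  by move=> AB; rewrite !mulmxA AB mul1mx -mulmxA -trmx_mul AB trmx1 mulmx1.
rewrite -(cancel _ _ Q' hK') hE' -(cancel _ _ E' hF') hD' -hS -hD -hE.
by rewrite !trmx_mul !mulmxA.
Qed.

Lemma tau_real_mxK w : tau_real (mxK w w^*).
Proof.
apply: tau_real_mx4; case=> [|[|[|[|//]]]] [|[|[|[|//]]]] _ _ /=;
  by rewrite ?rmorphN /= ?conjCK ?conjC1 ?conjC0.
Qed.

Lemma tau_real_mxKinv w : tau_real (mxKinv w w^*).
Proof.
apply: tau_real_mx4; case=> [|[|[|[|//]]]] [|[|[|[|//]]]] _ _ /=;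
  by rewrite ?conjC0 // rmorphM fmorphV ?rmorphN /= conjC_nat ?conjCK ?conjC1.
Qed.

Lemma tau_real_mxS (k : R) : tau_real (mxS k%:C).
Proof.
apply: tau_real_mx4; case=> [|[|[|[|//]]]] [|[|[|[|//]]]] _ _ /=;
  by rewrite ?conjC0 ?conjC1 ?conjCR.
Qed.

Lemma tau_real_mxF (p s h m N : C) : p^* = p -> s^* = s -> h^* = h ->
  tau_real (mxF p s h m m^* N N^*).
Proof.
move=> hp hs hh; apply: tau_real_mx4; case=> [|[|[|[|//]]]] [|[|[|[|//]]]] _ _ /=;
  by rewrite ?conjC0 ?conjC1 // !rmorphM ?rmorphN ?rmorphD ?fmorphV /= ?conjCK ?hp ?hs ?hh.
Qed.

Lemma tau_real_mxB (p s h m N : C) : p^* = p -> s^* = s -> h^* = h ->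
  tau_real (mxB p s h m m^* N N^*).
Proof.
move=> hp hs hh; apply: tau_real_mx4; case=> [|[|[|[|//]]]] [|[|[|[|//]]]] _ _ /=;
  by rewrite ?conjC0 ?conjC1 // !rmorphM ?rmorphN ?rmorphD ?fmorphV /= ?conjCK ?hp ?hs ?hh.
Qed.

Lemma tau_real_Lmx k l T : tau_real (Lmx k l T).
Proof.
exact (tau_realM (tau_real_mxKinv _) (tau_realM (tau_real_mxB _ _ (conjCR _) (conjCR _) (conjCR _))
  (tau_realM (tau_real_mxS _) (tau_realM
    (tau_real_mxF _ _ (conjCR _) (conjCR _) (conjCR _)) (tau_real_mxK _))))).
Qed.

Section Rescaled.
Variables (e e' k l : R).
Hypotheses (e01 : 0 < e < 1) (e01' : 0 < e' < 1) (k0 : 0 < k) (l0 : 0 < l).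
Hypotheses (kE : k ^+ 2 = (1 - e') / (1 - e)).
Hypotheses (lE : l ^+ 2 = k ^+ 2 * (1 + e) / (1 + e')).
Variable T : param.
Hypothesis TK : in_param e T.
Local Notation T' := (resc (k ^+ 2) l T).

Let e0 : 0 < e. Proof. by case/andP: e01. Qed.
Let e0' : 0 < e'. Proof. by case/andP: e01'. Qed.
Let w1 : cw T * (cw T)^* = 1. Proof. exact: cw_unit (in_param_neq0 e0 TK). Qed.
Let ch' := in_chart_rescale e01 e01' kE lE TK.

Let g1 : cabs (cN T) ^+ 2 < 1.
Proof. by rewrite (le_lt_trans (in_chart_N e0 TK)) // gtrBl. Qed.

Let g1' : l ^+ 2 * cabs (cN T) ^+ 2 < 1.
Proof. by rewrite -cabs_rescale_N (le_lt_trans (in_chart_N e0' ch')) // gtrBl. Qed.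

Lemma resc_in_param : in_param e' T'.
Proof.
by rewrite /in_param (cp_unchart e0' w1 ch') (cm_unchart e0' w1 ch') (cN_unchart e0' w1 ch').
Qed.

Lemma LmxK : Lmx k^-1 l^-1 T' *m Lmx k l T = 1%:M.
Proof.
have [||h1 h2 h3] := rescaleK (k := k ^+ 2) (l := l) (cp T) (cm T) _ _ g1 g1'.
- by rewrite sqrf_eq0 gt_eqF.
- by rewrite gt_eqF.
rewrite {1}/Lmx (cp_unchart e0' w1 ch') (cm_unchart e0' w1 ch') (cN_unchart e0' w1 ch').
rewrite (cw_unchart e0' w1 ch') exprVn h1 h2 h3 /Lmx.
apply: frame_change_inv; first exact: (mxK_inv two_neq0 w1).
- exact: (coframeK _ e0 (in_chart_pre TK)).
- exact: (frameK _ e0' (in_chart_pre ch')).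
- by rewrite fmorphV mxS_inv // (inj_eq (@complexI R)) gt_eqF.
Qed.

Lemma Lmx_gram : Lmx k l T *m gram T *m (Lmx k l T)^T = gram T'.
Proof.
have gT := gram_unchart (cp T) (cm T) (cN T) w1.
rewrite (unchartK e0 TK) in gT.
have gD := frame_gram (rescale_N l (cN T)) e0' (in_chart_pre ch').
rewrite rescale_dcoef rescale_Dcoef // in gD.
rewrite [(k ^+ 2 * _)%:C]rmorphM (rmorphM _ (k ^+ 2)%:C) /= conjCR rmorphXn in gD.
have gS := mxS_gram k%:C (dcoef (cp T) (cN T))%:C (Dcoef (cm T) (cN T)) (Dcoef (cm T) (cN T))^*.
exact: (frame_change_gram (mxK_inv two_neq0 w1) (frameK _ e0' (in_chart_pre ch')) gT
  (frame_gram _ e0 (in_chart_pre TK)) gS gD (gram_unchart _ _ _ w1)).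
Qed.

End Rescaled.
End Rescaling.

(** * Irreducible representations *)

Section Operators.
Variables (R : realType) (H : hilbertType R).
Local Notation C := R[i].
Local Notation param := (C * C * C)%type.
Implicit Types (T : param) (M : 'M[C]_4) (X : 'I_4 -> {linear H -> H}).

Definition mact M (X : 'I_4 -> H -> H) (i : 'I_4) (v : H) : H := \sum_j M i j *: X j v.

Lemma mact_mul M N (X : 'I_4 -> H -> H) i v : mact M (mact N X) i v = mact (M *m N) X i v.
Proof.
rewrite /mact; under eq_bigr do rewrite scaler_sumr.
rewrite exchange_big /=; apply: eq_bigr => j _.
by rewrite mxE scaler_suml; apply: eq_bigr => l _; rewrite scalerA.
Qed.

Lemma mact1 (X : 'I_4 -> H -> H) i v : mact 1%:M X i v = X i v.
Proof.
rewrite /mact (bigD1 i) //= mxE eqxx scale1r big1 ?addr0 // => j ji.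
by rewrite mxE eq_sym (negbTE ji) scale0r.
Qed.

Lemma eq_mact M (X Y : 'I_4 -> H -> H) i v :
  (forall j, X j =1 Y j) -> mact M X i v = mact M Y i v.
Proof. by move=> XY; apply: eq_bigr => j _; rewrite XY. Qed.

Definition has_gram (X : 'I_4 -> H -> H) (G : 'M[C]_4) : Prop :=
  forall i j v, X i (X j v) + X j (X i v) = G i j *: v.

Lemma mact_gram M X (G : 'M[C]_4) :
  has_gram X G -> has_gram (mact M X) (M *m G *m M^T).
Proof.
move=> hG i j v.
have E a b : mact M X a (mact M X b v) = \sum_c \sum_d (M a c * M b d) *: X c (X d v).
  rewrite /mact; apply: eq_bigr => c _.
  rewrite linear_sum scaler_sumr; apply: eq_bigr => d _.
  by rewrite linearZ scalerA.
rewrite !E [X in _ + X]exchange_big /= -big_split /= !mxE scaler_suml.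
under [RHS]eq_bigr do rewrite !mxE mulr_suml scaler_suml.
rewrite [RHS]exchange_big; apply: eq_bigr => c _ /=.
rewrite -big_split; apply: eq_bigr => d _ /=.
by rewrite [M j d * _]mulrC -scalerDr hG scalerA mulrAC.
Qed.

Lemma mact_adj M X : tau_real M ->
  (forall i, adjoint_of (X i) (X (tau i))) ->
  forall i, adjoint_of (mact M X i) (mact M X (tau i)).
Proof.
move=> hM hX i u v; rewrite /mact.
have h0l : hdot 0 v = 0 by rewrite linear0l.
have h0r : hdot u 0 = 0 by rewrite linear0.
rewrite (big_morph (hdot ^~ v) (fun a b => hdotDl a b v) h0l).
rewrite (big_morph (hdot u) (hdotDr u) h0r) [RHS](reindex_inj (inv_inj tauK)) /=.
apply: eq_bigr => j _.
by rewrite hdotZl (hdotZr (M (tau i) (tau j))) hM conjCK hX.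
Qed.

(** The order agrees with [gramX] and places the adjoint of entry i at [tau i]. *)
Definition ops4 (A1 S2 S1 A2 : {linear H -> H}) (i : 'I_4) : {linear H -> H} :=
  nth A1 [:: A1; S2; S1; A2] i.

Definition is_param T (A1 A2 : H -> H) : Prop :=
  [/\ forall v, A1 (A1 v) + A1 (A1 v) = T.1.1 *: v,
      forall v, A2 (A2 v) + A2 (A2 v) = T.1.2 *: v &
      forall v, A1 (A2 v) + A2 (A1 v) = T.2 *: v].

Lemma scale_inj (v : H) (a b : C) : v != 0 -> a *: v = b *: v -> a = b.
Proof.
move=> v0 /eqP; rewrite -subr_eq0 -scalerBl scaler_eq0 (negbTE v0) orbF.
by rewrite subr_eq0 => /eqP.
Qed.

Section Rep.
Variables A1 A2 S1 S2 : {linear H -> H}.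
Local Notation X := (ops4 A1 S2 S1 A2).

Hypothesis rep : wcar_rep A1 A2 S1 S2.

Let adj1 := wcar_adj1 rep.
Let adj2 := wcar_adj2 rep.

Lemma wcar_rel12_adj v : S2 (A1 v) = - A1 (S2 v).
Proof.
apply: hdot_ext => w.
by rewrite hdotNl !adj1 !(adjoint_sym adj2) adj1 (wcar_rel12 rep) hdotNr.
Qed.

Lemma ops4_adj i : adjoint_of (X i) (X (tau i)).
Proof.
case: i => [[|[|[|[|//]]]] hi]; rewrite /ops4 /tau /= inordK //=.
- exact: adjoint_sym.
- exact: adjoint_sym.
Qed.

Lemma adj_anticommutator (P Q P' Q' : {linear H -> H}) (c : C) :
  adjoint_of P P' -> adjoint_of Q Q' ->
  (forall v, P (Q v) + Q (P v) = c *: v) ->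
  forall v, P' (Q' v) + Q' (P' v) = c^* *: v.
Proof.
move=> hP hQ h v; apply: hdot_ext => w.
rewrite hdotDl hdotZl (adjoint_sym hP) (adjoint_sym hQ) (adjoint_sym hQ) (adjoint_sym hP).
by rewrite -hdotDr addrC h hdotZr.
Qed.

Lemma wcar_gram T : is_param T A1 A2 -> has_gram X (gram T).
Proof.
case=> h1 h2 h3 i j v.
have h1' := adj_anticommutator adj1 adj1 h1.
have h2' := adj_anticommutator adj2 adj2 h2.
have h3' := adj_anticommutator adj1 adj2 h3.
have e01 w : A1 (S2 w) + S2 (A1 w) = 0 by rewrite wcar_rel12_adj subrr.
have e02 w : A1 (S1 w) + S1 (A1 w) = w by rewrite addrC (wcar_rel1 rep).
have e13 w : S2 (A2 w) + A2 (S2 w) = w := wcar_rel2 rep w.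
have e23 w : S1 (A2 w) + A2 (S1 w) = 0 by rewrite (wcar_rel12 rep) addNr.
case: i => [[|[|[|[|//]]]] hi]; case: j => [[|[|[|[|//]]]] hj];
  rewrite /ops4 /gram /gramX mxE /= ?scale0r ?scale1r;
  by rewrite ?h1 ?h1' ?h2 ?h2' ?h3 ?h3' ?e01 ?e02 ?e13 ?e23 // addrC
     ?h3 ?h3' ?e01 ?e02 ?e13 ?e23.
Qed.

Lemma wcar_contractive v : nrm (A1 v) <= nrm v /\ nrm (S1 v) <= nrm v.
Proof.
have : nrm (A1 v) ^+ 2 + nrm (S1 v) ^+ 2 = nrm v ^+ 2.
  rewrite !nrm_sqr adj1 (adjoint_sym adj1) -ReD -hdotDr (wcar_rel1 rep) //.
move=> h; split; rewrite -(@ler_pXn2r _ 2) ?nnegrE ?nrm_ge0 // -h.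
  by rewrite lerDl sqr_ge0.
by rewrite lerDr sqr_ge0.
Qed.

End Rep.

Lemma wcar_rep_swap (A1 A2 S1 S2 : {linear H -> H}) : wcar_rep A1 A2 S1 S2 -> wcar_rep A2 A1 S2 S1.
Proof.
move=> rep; have := wcar_rel12_adj rep; case: rep => *; split=> //.
Qed.

Lemma irreducible_ops_swap (A1 A2 S1 S2 : {linear H -> H}) :
  irreducible_ops A1 A2 S1 S2 -> irreducible_ops A2 A1 S2 S1.
Proof.
by move=> [h irr]; split=> // V Vc Vi; apply: irr => // v /Vi[].
Qed.

(** A1^2 commutes with the whole family: the anticommutator of A1 with each of A1, A2, S1, S2 is a
    scalar, so moving A1 twice past any of them cancels. Schur's lemma applies to its real part Z1
    and imaginary part Z2, where A1^2 = Z1 + i Z2. *)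
Lemma wcar_square_scalar (A1 A2 S1 S2 : {linear H -> H}) (y : C) :
  wcar_rep A1 A2 S1 S2 -> irreducible_ops A1 A2 S1 S2 ->
  (forall v, A2 (A1 v) + A1 (A2 v) = y *: v) ->
  exists c : C, forall v, A1 (A1 v) = c *: v.
Proof.
move=> rep irr hy; have adj1 := wcar_adj1 rep; have adj2 := wcar_adj2 rep.
have r1 v : S1 (A1 v) = v - A1 (S1 v) by apply/eqP; rewrite eq_sym subr_eq (wcar_rel1 rep).
have r12 := wcar_rel12 rep; have r21 := wcar_rel12_adj rep.
have ry v : A1 (A2 v) = y *: v - A2 (A1 v) by rewrite -hy addrAC subrr add0r.
have hy' := adj_anticommutator adj2 adj1 hy.
have ry' v : S1 (S2 v) = y^* *: v - S2 (S1 v) by rewrite -hy' addrAC subrr add0r.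
have AA2 v : A1 (A1 (A2 v)) = A2 (A1 (A1 v)).
  by rewrite ry linearB (linearZ_LR A1) ry opprB addrC subrK.
have AS1 v : A1 (A1 (S1 v)) = S1 (A1 (A1 v)).
  have rS w : A1 (S1 w) = w - S1 (A1 w) 
    by apply/eqP; rewrite eq_sym subr_eq addrC (wcar_rel1 rep).
  by rewrite rS linearB /= rS opprB addrC subrK.
have AS2 v : A1 (A1 (S2 v)) = S2 (A1 (A1 v)).
  by rewrite !r21 (linearN A1) opprK.
have SA1 v : S1 (S1 (A1 v)) = A1 (S1 (S1 v)).
  by rewrite r1 linearB /= r1 opprB addrC subrK.
have SA2 v : S1 (S1 (A2 v)) = A2 (S1 (S1 v)).
  by rewrite r12 (linearN S1) r12 opprK.
have SS2 v : S1 (S1 (S2 v)) = S2 (S1 (S1 v)).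
  by rewrite ry' linearB (linearZ_LR S1) ry' opprB addrC subrK.
have A1c : continuous A1 := wcar_cont1 rep.
have A2c : continuous A2 := wcar_cont2 rep.
have S1c : continuous S1.
  by apply: (@nrm_linear_continuous _ _ _ 1) => v; rewrite mul1r; case: (wcar_contractive rep v).
have S2c : continuous S2.
  apply: (@nrm_linear_continuous _ _ _ 1) => v; rewrite mul1r.
  by case: (wcar_contractive (wcar_rep_swap rep) v).
have AAle v : nrm (A1 (A1 v)) <= nrm v.
  by have [h _] := wcar_contractive rep v; have [h' _] := wcar_contractive rep (A1 v);
    exact: le_trans h.
have SSle v : nrm (S1 (S1 v)) <= nrm v.
  by have [_ h] := wcar_contractive rep v; have [_ h'] := wcar_contractive rep (S1 v);
    exact: le_trans h.
pose h2 : R := 2^-1.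
have h20 : 0 <= h2 by rewrite invr_ge0.
pose Z1 : {linear H -> H} := h2%:C \*: ((A1 \o A1) \+ (S1 \o S1)).
pose Z2 : {linear H -> H} := (h2%:C * 'i) \*: ((S1 \o S1) \- (A1 \o A1)).
have Z1E v : Z1 v = h2%:C *: (A1 (A1 v) + S1 (S1 v)) by [].
have Z2E v : Z2 v = (h2%:C * 'i) *: (S1 (S1 v) - A1 (A1 v)) by [].
have hAA u v : hdot (A1 (A1 u)) v = hdot u (S1 (S1 v)) by rewrite !adj1.
have hSS u v : hdot (S1 (S1 u)) v = hdot u (A1 (A1 v)) by rewrite !(adjoint_sym adj1).
have [||//|a ha] := @schur_selfadjoint _ _ _ _ _ _ irr A1c A2c S1c S2c Z1.
- by move=> u v; rewrite !Z1E hdotZl (hdotZr h2%:C) conjCR hdotDl hAA hSS hdotDr addrC.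
- move=> v; rewrite Z1E nrmZ ger0_norm //.
  have := nrmD (A1 (A1 v)) (S1 (S1 v)); have := AAle v; have := SSle v; rewrite /h2; lra.
- split=> v; rewrite !Z1E.
  + by rewrite SA1 (linearZ_LR A1) (linearD A1).
  + by rewrite AA2 SA2 (linearZ_LR A2) (linearD A2).
  + by rewrite AS1 (linearZ_LR S1) (linearD S1).
  + by rewrite AS2 SS2 (linearZ_LR S2) (linearD S2).
have [||//|b hb] := @schur_selfadjoint _ _ _ _ _ _ irr A1c A2c S1c S2c Z2.
- move=> u v; rewrite !Z2E hdotZl (hdotZr (h2%:C * 'i)) rmorphM /= conjCR hdotDl hdotNl.
  have -> : 'i^* = - 'i :> C by apply/eqP; rewrite eq_complex /= oppr0 !eqxx.
  by rewrite hAA hSS hdotDr hdotNr; ring.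
- move=> v; rewrite Z2E -scalerA nrmZ ger0_norm //.
  have -> : nrm ('i *: (S1 (S1 v) - A1 (A1 v))) = nrm (S1 (S1 v) - A1 (A1 v)).
    by rewrite /nrm normrZ normc_def /= expr0n expr1n add0r sqrtr1 mul1r.
  have := nrmD (S1 (S1 v)) (- A1 (A1 v)); rewrite nrmN.
  by have := AAle v; have := SSle v; rewrite /h2; lra.
- split=> v; rewrite !Z2E.
  + by rewrite SA1 (linearZ_LR A1) (linearB A1).
  + by rewrite AA2 SA2 (linearZ_LR A2) (linearB A2).
  + by rewrite AS1 (linearZ_LR S1) (linearB S1).
  + by rewrite AS2 SS2 (linearZ_LR S2) (linearB S2).
exists (a%:C + 'i * b%:C) => v.
have ii : ('i : C) * 'i = -1 by rewrite -expr2 sqr_i.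
have hE : (h2%:C : C) = 2^-1 by rewrite fmorphV rmorph_nat.
rewrite scalerDl -ha -scalerA -hb Z1E Z2E; apply: hdot_ext => w.
by rewrite !hdotlE hE; field: ii.
Qed.

End Operators.

Section Irreps.
Variables (R : realType) (H : hilbertType R).
Local Notation C := R[i].
Local Notation param := (C * C * C)%type.
Implicit Types (T : param).

Lemma tau_inord (i : nat) : (i < 4)%N -> tau (inord i) = inord ((i + 2) %% 4).
Proof. by move=> hi; rewrite /tau inordK. Qed.

Lemma half_scale (u v : H) (c : C) : u + u = (2 * c) *: v -> u = c *: v.
Proof.
move=> h; apply: (scalerI (two_neq0 R)).
by rewrite scalerA -h scaler_nat mulr2n.
Qed.

(** Positivity of the form on the span of entry 1 of M X and its adjoint, entry 3. It serves for the
    element F and for the element D. *)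
Lemma gram_norm_le (M G : 'M[C]_4) (X : 'I_4 -> {linear H -> H}) (u : C) (r : R) (v : H) :
  v != 0 -> tau_real M -> (forall i, adjoint_of (X i) (X (tau i))) -> has_gram X G ->
  (M *m G *m M^T) (inord 1) (inord 1) = 2 * u ->
  (M *m G *m M^T) (inord 1) (inord 3) = 2 * r%:C -> cabs u <= r.
Proof.
move=> v0 hM hX hG hu hr.
have gM := mact_gram M hG.
have adj := mact_adj hM hX (inord 1); rewrite tau_inord // in adj.
apply: (anticommutator_norm_le v0 adj); first by apply: half_scale; rewrite gM hu.
by rewrite gM hr rmorphM rmorph_nat.
Qed.

Lemma is_param_exists e (A1 A2 S1 S2 : {linear H -> H}) :
  wcar_irrep e A1 A2 S1 S2 -> exists T, is_param T A1 A2.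
Proof.
move=> [rep irr [y [hy _]]].
have [a ha] := wcar_square_scalar rep irr hy.
have [|b hb] := wcar_square_scalar (wcar_rep_swap rep) (irreducible_ops_swap irr) (y := y).
  by move=> v; rewrite addrC hy.
exists (a + a, b + b, y); split=> v /=.
- by rewrite ha scalerDl.
- by rewrite hb scalerDl.
- by rewrite addrC hy.
Qed.

(** The bound on |y| is part of the hypothesis; |m| <= 2 - p is the positivity for F, and |D1| <= d
    that for D, which also forces d >= 0. *)
Lemma wcar_in_param e (A1 A2 S1 S2 : {linear H -> H}) T : 0 < e ->
  wcar_irrep e A1 A2 S1 S2 -> is_param T A1 A2 -> in_param e T.
Proof.
move=> e0 [rep irr [y [hy /andP[ey y1]]]] hT.
have [[v v0] _] := irr.
have [_ _ h3] := hT.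
have yE : T.2 = y by apply: (scale_inj v0); rewrite -h3 addrC hy.
have cy : e <= cabs T.2 <= 1.
  by rewrite yE -lecR -(lecR _ 1) -cabsE ey.
have y0 : T.2 != 0 by case/andP: cy => h _; rewrite -cabs_eq0 gt_eqF // (lt_le_trans e0).
have w1 := cw_unit y0.
have hX := ops4_adj rep; have hG := wcar_gram rep hT.
have gE := gramX_chart (cp T) (cm T) (cn T) w1; rewrite -(param_chart y0) in gE.
have p12 : 1 + e <= cp T <= 2 by rewrite /cp lerD2l -[2]/(1 + 1) lerD2l.
have mle : cabs (cm T) <= 2 - cp T.
  apply: (gram_norm_le v0 (tau_real_mxK (cw T)) hX hG); rewrite gE /gramE mxE mx4E //=.
  by rewrite rmorphB rmorph_nat.
have pre : pre_chart e (cp T) (cm T) by [].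
have gF := frame_gram (cN T) e0 pre.
have sb : (scoef (cp T) (cm T))%:C * (cN T)^* = (cn T)^*.
  by rewrite -[in RHS](scoef_cN e0 pre) [RHS]rmorphM /= conjCR.
rewrite (scoef_cN e0 pre) sb -gE in gF.
have Dle : cabs (Dcoef (cm T) (cN T)) <= dcoef (cp T) (cN T).
  apply: (gram_norm_le v0 (M := frame (cp T) (cm T) (cN T) *m mxK (cw T) (cw T)^*) _ hX hG).
  - by apply: tau_realM; [exact: tau_real_mxF (conjCR _) (conjCR _) (conjCR _)|exact: tau_real_mxK].
  - by rewrite trmx_mul !mulmxA; rewrite !mulmxA in gF; rewrite gF /gramD mxE mx4E.
  - by rewrite trmx_mul !mulmxA; rewrite !mulmxA in gF; rewrite gF /gramD mxE mx4E.
split=> //; exact: le_trans (cabs_ge0 _) Dle.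
Qed.

Section Rescaled.
Variables (e e' k l : R).
Hypotheses (e01 : 0 < e < 1) (e01' : 0 < e' < 1) (k0 : 0 < k) (l0 : 0 < l).
Hypotheses (kE : k ^+ 2 = (1 - e') / (1 - e)).
Hypotheses (lE : l ^+ 2 = k ^+ 2 * (1 + e) / (1 + e')).
Variables (A1 A2 S1 S2 B1 B2 Z1 Z2 : {linear H -> H}) (T : param).
Hypotheses (irr : wcar_irrep e A1 A2 S1 S2) (hT : is_param T A1 A2).
Hypotheses (B1c : continuous B1) (B2c : continuous B2).
Local Notation X := (ops4 A1 S2 S1 A2).
Hypothesis hB : forall i, ops4 B1 Z2 Z1 B2 i =1 mact (Lmx k l T) X i.
Local Notation T' := (resc (k ^+ 2) l T).

Let e0 : 0 < e. Proof. by case/andP: e01. Qed.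
Let TK : in_param e T. Proof. exact: wcar_in_param e0 irr hT. Qed.
Let TK' : in_param e' T' := resc_in_param e01 e01' kE lE TK.

Lemma rescaled_gram : has_gram (ops4 B1 Z2 Z1 B2) (gram T').
Proof.
have [rep _ _] := irr; have G := mact_gram (Lmx k l T) (wcar_gram rep hT).
rewrite (Lmx_gram e01 e01' kE lE TK) in G.
by move=> i j v; rewrite !hB -G /mact; congr (_ + _); apply: eq_bigr => c _; rewrite hB.
Qed.

Lemma rescaled_is_param : is_param T' B1 B2.
Proof.
have G := rescaled_gram; split=> v.
- have := G (inord 0) (inord 0) v; rewrite /ops4 !inordK //= => ->.
  by rewrite /gram /gramX mx4E.
- have := G (inord 3) (inord 3) v; rewrite /ops4 !inordK //= => ->.
  by rewrite /gram /gramX mx4E.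
- have := G (inord 0) (inord 3) v; rewrite /ops4 !inordK //= => ->.
  by rewrite /gram /gramX mx4E.
Qed.

Lemma rescaled_back i v : mact (Lmx k^-1 l^-1 T') (ops4 B1 Z2 Z1 B2) i v = X i v.
Proof.
have LX : mact (Lmx k^-1 l^-1 T' *m Lmx k l T) X i v = X i v.
  by rewrite (LmxK e01 e01' k0 l0 kE lE TK) mact1.
by rewrite -[RHS]LX -[RHS]mact_mul; apply: eq_mact => j u; exact: hB.
Qed.

(** The relations are read off the rescaled Gram matrix. A subspace invariant under the new
    operators is invariant under the old ones, which are combinations of the new by
    [rescaled_back]. *)
Lemma rescaled_irrep : wcar_irrep e' B1 B2 Z1 Z2.
Proof.
have [rep [[v v0] min] _] := irr; have G := rescaled_gram.
have adj i : adjoint_of (ops4 B1 Z2 Z1 B2 i) (ops4 B1 Z2 Z1 B2 (tau i)).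
  by move=> a b; rewrite !hB; apply: mact_adj; [exact: tau_real_Lmx | exact: ops4_adj].
split.
- split=> //.
  + by have := adj (inord 0); rewrite tau_inord // /ops4 !inordK.
  + by have := adj (inord 3); rewrite tau_inord // /ops4 !inordK.
  + move=> w; have := G (inord 2) (inord 0) w; rewrite /ops4 !inordK //= => ->.
    by rewrite /gram /gramX mx4E //= scale1r.
  + move=> w; have := G (inord 1) (inord 3) w; rewrite /ops4 !inordK //= => ->.
    by rewrite /gram /gramX mx4E //= scale1r.
  + move=> w; have := G (inord 2) (inord 3) w; rewrite /ops4 !inordK //= => h.
    apply/eqP; rewrite -addr_eq0 h.
    by rewrite /gram /gramX mx4E //= scale0r.
- split; first by exists v.
  move=> V Vc Vi; apply: min => // w Vw.
  have [Vcl V0 Vlin] := Vc.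
  have VB i u : V u -> V (ops4 B1 Z2 Z1 B2 i u).
    by move=> /Vi[? ? ? ?]; case: i => [[|[|[|[|//]]]] hi].
  have VX i : V (X i w).
    rewrite -rescaled_back /mact; elim/big_ind: _ => //.
    + by move=> a b Va Vb; rewrite -[a]scale1r; apply: Vlin.
    + by move=> j _; rewrite -[_ *: _]addr0; apply: Vlin => //; exact: VB.
  have := VX (inord 0); have := VX (inord 1); have := VX (inord 2); have := VX (inord 3).
  by rewrite /ops4 !inordK.
- have [_ _ h3] := rescaled_is_param.
  exists T'.2; split=> [w|]; first by rewrite addrC h3.
  have [/andP[h1 h2] _ _ _] := TK'.
  rewrite cabsE lecR -(rmorph1 (real_complex R)) lecR.
  by move: h1 h2; rewrite /cp -[2]/(1 + 1) !lerD2l => -> ->.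
Qed.

End Rescaled.
End Irreps.

(** * Scalar functions realized in the enveloping algebra *)

Section Enveloping.
Variables (R : realType) (eps : R) (E : cstarAlgType R) (a1 a2 : E).
Hypothesis hE : is_wcar_enveloping eps a1 a2.
Hypothesis eps01 : 0 < eps < 1.
Local Notation C := R[i].
Local Notation param := (C * C * C)%type.
Implicit Types (T : param) (f : param -> C) (g : param -> R).

Definition env_irrep (H : hilbertType R) (pi : E -> {linear H -> H}) : Prop :=
  star_rep pi /\ wcar_irrep eps (pi a1) (pi a2) (pi (star a1)) (pi (star a2)).

Definition spec T : Prop := exists (H : hilbertType R) (pi : E -> {linear H -> H}),
  env_irrep pi /\ is_param T (pi a1) (pi a2).

Lemma env_irrep_le (H : hilbertType R) (pi : E -> {linear H -> H}) x v :
  env_irrep pi -> nrm (pi x v) <= nrm x * nrm v.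
Proof.
move=> [rep irr]; have [-> | v0] := eqVneq v 0.
  by rewrite linear0 !nrm0 mulr0.
have nv : 0 < nrm v by rewrite lt_def nrm_ge0 nrm_eq0 v0.
have [ub _] := env_norm hE x.
have iv : 0 < (nrm v)^-1 by rewrite invr_gt0.
have /ub : [set r : R[i] | exists (H : hilbertType R) (pi : E -> {linear H -> H}),
     [/\ star_rep pi, wcar_irrep eps (pi a1) (pi a2) (pi (star a1)) (pi (star a2)) &
      exists v : H, `|v| <= 1 /\ r = `|pi x v| ] ] `|pi x ((nrm v)^-1%:C *: v)|.
  exists H, pi; split=> //; exists ((nrm v)^-1%:C *: v); split=> //.
  by rewrite nrmE -(rmorph1 (real_complex R)) lecR nrmZ gtr0_norm // mulVf // gt_eqF.
rewrite linearZ /= !nrmE lecR nrmZ gtr0_norm // => h.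
by rewrite -ler_pdivrMr // mulrC.
Qed.

Lemma env_norm_le x (c : R) :
  (forall (H : hilbertType R) (pi : E -> {linear H -> H}) v,
     env_irrep pi -> nrm v <= 1 -> nrm (pi x v) <= c) -> nrm x <= c.
Proof.
move=> h; have [_ lb] := env_norm hE x.
rewrite -lecR -nrmE; apply: lb => _ [H [pi [rep irr [v [v1 ->]]]]].
rewrite nrmE lecR; apply: h => //.
by rewrite -lecR -nrmE rmorph1.
Qed.

(** A substitute for functional calculus: f is realized when a single element of E acts as the
    scalar f (T) in every representation of the family. Such functions are closed under ring
    operations, conjugation and uniform geometric limits. *)
Definition rlz f : Prop := exists z : E,
  forall (H : hilbertType R) (pi : E -> {linear H -> H}) T,
    env_irrep pi -> is_param T (pi a1) (pi a2) -> forall v, pi z v = f T *: v.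

Lemma spec_in_param T : spec T -> in_param eps T.
Proof.
move=> [H [pi [[_ irr] hT]]]; apply: wcar_in_param irr hT.
by case/andP: eps01.
Qed.

Lemma rlz_ext f f' : (forall T, spec T -> f T = f' T) -> rlz f -> rlz f'.
Proof.
move=> e [z hz]; exists z => H pi T irr hT v.
by rewrite (hz _ _ _ irr hT) e //; exists H, pi.
Qed.

Lemma rlz_cst (c : C) : rlz (fun=> c).
Proof. by exists (c *: 1) => H pi T [rep _] _ v; rewrite rep_scale // rep_one. Qed.

Lemma rlzD f f' : rlz f -> rlz f' -> rlz (fun T => f T + f' T).
Proof.
move=> [z hz] [z' hz']; exists (z + z') => H pi T irr hT v.
by rewrite rep_add ?(hz _ _ _ irr hT) ?(hz' _ _ _ irr hT) ?scalerDl //; case: irr.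
Qed.

Lemma rlzM f f' : rlz f -> rlz f' -> rlz (fun T => f T * f' T).
Proof.
move=> [z hz] [z' hz']; exists (z * z') => H pi T irr hT v.
by rewrite rep_mul ?(hz' _ _ _ irr hT) ?(hz _ _ _ irr hT) ?scalerA //; case: irr.
Qed.

Lemma rlzN f : rlz f -> rlz (fun T => - f T).
Proof.
move=> hf; apply: rlz_ext (rlzM (rlz_cst (-1)) hf) => T _.
by rewrite mulN1r.
Qed.

Lemma rlzB f f' : rlz f -> rlz f' -> rlz (fun T => f T - f' T).
Proof. by move=> hf hf'; apply: rlzD hf (rlzN hf'). Qed.

Lemma rlzX n f : rlz f -> rlz (fun T => f T ^+ n).
Proof.
move=> hf; elim: n => [|n IH]; first exact: rlz_cst.
by apply: rlz_ext (rlzM hf IH) => T _; rewrite exprS.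
Qed.

Lemma rlz_conj f : rlz f -> rlz (fun T => (f T)^*).
Proof.
move=> [z hz]; exists (star z) => H pi T irr hT v; apply: hdot_ext => w.
rewrite (adjoint_sym (rep_star irr.1 z)) (hz _ _ _ irr hT).
by rewrite hdotZl (hdotZr (f T)).
Qed.

Lemma rlz_al : rlz (fun T => T.1.1).
Proof.
exists (a1 * a1 + a1 * a1) => H pi T [rep _] [h _ _] v.
by rewrite rep_add // rep_mul // h.
Qed.

Lemma rlz_de : rlz (fun T => T.1.2).
Proof.
exists (a2 * a2 + a2 * a2) => H pi T [rep _] [_ h _] v.
by rewrite rep_add // rep_mul // h.
Qed.

Lemma rlz_y : rlz (fun T => T.2).
Proof.
exists (a1 * a2 + a2 * a1) => H pi T [rep _] [_ _ h] v.
by rewrite rep_add // !rep_mul // h.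
Qed.

Lemma nrm_scale (H : hilbertType R) (c : C) (v : H) : nrm (c *: v) = cabs c * nrm v.
Proof. by apply: (@complexI R); rewrite -nrmE normrZ nrmE rmorphM /= cabsE. Qed.

Lemma rlz_bounded f : rlz f -> exists2 M : R, 0 < M & forall T, spec T -> cabs (f T) <= M.
Proof.
(* The summand 1 only makes the bound strictly positive. *)
move=> [z hz]; exists (nrm z + 1); first by rewrite ltr_wpDl ?nrm_ge0.
move=> T [H [pi [irr hT]]]; have [_ [[v v0] _] _] := irr.2.
have nv : 0 < nrm v by rewrite lt_def nrm_ge0 nrm_eq0 v0.
rewrite (@le_trans _ _ (nrm z)) ?lerDl // -(ler_pM2r nv).
by rewrite -nrm_scale -(hz _ _ _ irr hT) env_irrep_le.
Qed.

Lemma rep_sub (H : hilbertType R) (pi : E -> {linear H -> H}) x y v :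
  star_rep pi -> pi (x - y) v = pi x v - pi y v.
Proof. by move=> rep; rewrite rep_add // -scaleN1r rep_scale // scaleN1r. Qed.

(** The norm of E is a supremum over representations in which the realizers are scalars, so uniform
    convergence of the functions makes the realizers Cauchy in E. *)
Lemma rlz_lim (fn : nat -> param -> C) f (M r : R) : 0 <= M -> 0 <= r < 1 ->
  (forall n, rlz (fn n)) -> (forall n T, spec T -> cabs (fn n T - f T) <= M * r ^+ n) ->
  rlz f.
Proof.
move=> M0 /andP[r0 r1] /choice[z hz] hf.
have r1' : 1 - r != 0 by rewrite subr_eq0 gt_eqF.
(* The majorant has increments 2 M r^n, and two consecutive functions differ by at most M r^(n+1) +
   M r^n. *)
have [||l zl] := @nrm_telescope_cvg _ _ z
  (fun n => 2 * M / (1 - r) * (1 - r ^+ n)) (2 * M / (1 - r)).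
- move=> n; apply: env_norm_le => H pi v irr v1.
  have [T hT] := is_param_exists irr.2.
  have sT : spec T by exists H, pi.
  rewrite rep_sub; last by case: irr.
  rewrite !(hz _ _ _ _ irr hT) -scalerBl nrm_scale.
  have : cabs (fn n.+1 T - fn n T) <= 2 * M * r ^+ n.
    have -> : fn n.+1 T - fn n T = (fn n.+1 T - f T) - (fn n T - f T).
      by rewrite opprB addrA subrK.
    rewrite (le_trans (cabsB _ _)) // -mulrA mulr_natl mulr2n lerD ?hf //.
    rewrite (le_trans (hf _ _ sT)) // ler_wpM2l // exprS ler_piMl ?exprn_ge0 // ltW //.
  have -> : 2 * M / (1 - r) * (1 - r ^+ n.+1) - 2 * M / (1 - r) * (1 - r ^+ n) = 2 * M * r ^+ n.
    by rewrite exprS; field.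
  apply: le_trans; rewrite -[leRHS]mulr1 ler_wpM2l ?cabs_ge0 //.
- move=> n; rewrite ler_piMr ?divr_ge0 ?mulr_ge0 ?subr_ge0 ?(ltW r1) //.
  by rewrite gerBl exprn_ge0.
exists l => H pi T irr hT v; apply/eqP; rewrite -subr_eq0; apply/eqP.
apply: nrm_small => e e0.
have sT : spec T by exists H, pi.
have K0 : 0 < 2 * (nrm v + 1) by rewrite mulr_gt0 // ltr_wpDl ?nrm_ge0.
have /cvg_nrmP/(_ _ (divr_gt0 e0 K0))[n0 hn0] := zl.
have [n1 hn1] : exists n1, forall n, (n1 <= n)%N -> M * r ^+ n < e / (2 * (nrm v + 1)).
  have : (fun n => M * r ^+ n) @ \oo --> (M * 0 : R).
    by apply: cvgMl_tmp; apply: cvg_expr; rewrite ger0_norm.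
  rewrite mulr0 => /cvgrPdist_lt/(_ _ (divr_gt0 e0 K0))[n1 _ h]; exists n1 => n /h /=.
  by rewrite sub0r normrN ger0_norm // mulr_ge0 ?exprn_ge0.
have [h0 h1] := (hn0 _ (leq_maxl n0 n1), hn1 _ (leq_maxr n0 n1)).
set n := maxn n0 n1 in h0 h1.
have A : nrm (pi l v - pi (z n) v) <= nrm (z n - l) * nrm v.
  by rewrite nrmC -rep_sub ?env_irrep_le //; case: irr.
have B : nrm (pi (z n) v - f T *: v) <= M * r ^+ n * nrm v.
  by rewrite (hz _ _ _ _ irr hT) -scalerBl nrm_scale ler_wpM2r ?nrm_ge0 ?hf.
have := nrmB (pi l v) (pi (z n) v) (f T *: v).
move: h0 h1; rewrite !ltr_pdivlMr // => h0 h1.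
have := nrm_ge0 v; have := nrm_ge0 (z n - l).
have : 0 <= M * r ^+ n by rewrite mulr_ge0 ?exprn_ge0.
move: (nrm (z n - l)) (M * r ^+ n) (nrm v) A B h0 h1 => p q t; lra.
Qed.

Definition rlzR g : Prop := rlz (fun T => (g T)%:C).

Lemma rlzR_cst (c : R) : rlzR (fun=> c).
Proof. exact: rlz_cst. Qed.

Lemma rlzRD g g' : rlzR g -> rlzR g' -> rlzR (fun T => g T + g' T).
Proof. by move=> h h'; apply: rlz_ext (rlzD h h') => T _; rewrite rmorphD. Qed.

Lemma rlzRB g g' : rlzR g -> rlzR g' -> rlzR (fun T => g T - g' T).
Proof. by move=> h h'; apply: rlz_ext (rlzB h h') => T _; rewrite rmorphB. Qed.

Lemma rlzRM g g' : rlzR g -> rlzR g' -> rlzR (fun T => g T * g' T).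
Proof. by move=> h h'; apply: rlz_ext (rlzM h h') => T _; rewrite rmorphM. Qed.

Lemma rlzRX n g : rlzR g -> rlzR (fun T => g T ^+ n).
Proof. by move=> h; apply: rlz_ext (rlzX n h) => T _; rewrite rmorphXn. Qed.

Lemma rlzR_cabs2 f : rlz f -> rlzR (fun T => cabs (f T) ^+ 2).
Proof. by move=> h; apply: rlz_ext (rlzM h (rlz_conj h)) => T _; rewrite cabs_sqr. Qed.

Lemma rlzR_bounded g : rlzR g -> exists2 M : R, 0 < M & forall T, spec T -> g T <= M.
Proof.
move=> /rlz_bounded[M M0 h]; exists M => // T /h; rewrite cabs_real.
exact: le_trans (ler_norm _).
Qed.

(** The iteration h + t (1 - g h) from 0 has error exactly g^-1 (1 - t g)^n. With t = 1 / (M + c)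
    and c <= g <= M, the ratio lies between 0 and 1 - t c < 1. *)
Lemma rlzR_inv g (c : R) : 0 < c -> (forall T, spec T -> c <= g T) -> rlzR g ->
  rlzR (fun T => (g T)^-1).
Proof.
move=> c0 gc hg; have [M M0 gM] := rlzR_bounded hg.
pose t := (M + c)^-1; have t0 : 0 < t by rewrite invr_gt0 addr_gt0.
have tc1 : t * c < 1 by rewrite mulrC ltr_pdivrMr ?addr_gt0 // mul1r ltrDr.
pose h := fix h n T : R := if n is n'.+1 then h n' T + t * (1 - g T * h n' T) else 0.
apply: (@rlz_lim (fun n T => (h n T)%:C) _ c^-1 (1 - t * c)).
- by rewrite invr_ge0 ltW.
- by rewrite subr_ge0 (ltW tc1) /= gtrBl mulr_gt0.
- elim=> [|n IH]; first exact: (rlzR_cst 0).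
  apply: (rlzRD IH); apply: (rlzRM (rlzR_cst t)); apply: (rlzRB (rlzR_cst 1)).
  exact: rlzRM hg IH.
move=> n T sT; have gT := gc T sT; have gT0 : 0 < g T := lt_le_trans c0 gT.
have tg : 0 <= 1 - t * g T.
  rewrite subr_ge0 mulrC ler_pdivrMr ?addr_gt0 // mul1r.
  by rewrite (le_trans (gM _ sT)) // lerDl ltW.
have -> : h n T = (g T)^-1 - (g T)^-1 * (1 - t * g T) ^+ n.
  elim: n => [|n /= ->]; first by rewrite expr0 mulr1 subrr.
  by rewrite exprS; field; rewrite gt_eqF.
rewrite rmorphB /= addrAC subrr add0r -rmorphN cabs_real normrN ger0_norm; last first.
  by rewrite mulr_ge0 ?exprn_ge0 // invr_ge0 ltW.
apply: ler_pM; rewrite ?exprn_ge0 ?invr_ge0 ?(ltW gT0) //.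
  by rewrite lef_pV2 ?posrE.
by rewrite lerXn2r ?nnegrE // ?subr_ge0 ?(ltW tc1) // lerB // ler_wpM2l // ltW.
Qed.

(** With x = sqrt g, the iteration s + t (g - s^2) multiplies the error x - s by 1 - t (x + s). The
    induction keeps s in [0, x], where the choice of t puts this factor between 0 and 1 - t sqrt
    c. *)
Lemma rlzR_sqrt g (c : R) : 0 < c -> (forall T, spec T -> c <= g T) -> rlzR g ->
  rlzR (fun T => Num.sqrt (g T)).
Proof.
move=> c0 gc hg; have [M M0 gM] := rlzR_bounded hg.
have sc0 : 0 < Num.sqrt c by rewrite sqrtr_gt0.
pose t := (2 * (Num.sqrt M + Num.sqrt c))^-1.
have sM0 : 0 < Num.sqrt M by rewrite sqrtr_gt0.
have d0 : 0 < 2 * (Num.sqrt M + Num.sqrt c) by rewrite mulr_gt0 // addr_gt0.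
have t0 : 0 < t by rewrite invr_gt0.
have tc1 : t * Num.sqrt c < 1 by rewrite mulrC ltr_pdivrMr // mul1r; lra.
pose s := fix s n T : R := if n is n'.+1 then s n' T + t * (g T - s n' T ^+ 2) else 0.
apply: (@rlz_lim (fun n T => (s n T)%:C) _ (Num.sqrt M) (1 - t * Num.sqrt c)).
- by rewrite ltW.
- by rewrite subr_ge0 (ltW tc1) /= gtrBl mulr_gt0.
- elim=> [|n IH]; first exact: (rlzR_cst 0).
  apply: (rlzRD IH); apply: (rlzRM (rlzR_cst t)); apply: (rlzRB hg).
  exact: rlzRX.
move=> n T sT; have gT := gc T sT; have gT0 : 0 < g T := lt_le_trans c0 gT.
set x := Num.sqrt (g T).
have xM : x <= Num.sqrt M by rewrite ler_wsqrtr // gM.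
have cx : Num.sqrt c <= x by rewrite ler_wsqrtr.
have x2 : g T = x ^+ 2 by rewrite sqr_sqrtr // ltW.
have x0 : 0 < x by rewrite sqrtr_gt0.
have r0 : 0 <= 1 - t * Num.sqrt c by rewrite subr_ge0 ltW.
suff /andP[s0 sx] : 0 <= x - s n T <= Num.sqrt M * (1 - t * Num.sqrt c) ^+ n.
  by rewrite -rmorphB cabs_real distrC ger0_norm.
suff /and3P[h1 h2 h3] : [&& 0 <= s n T, 0 <= x - s n T &
    x - s n T <= Num.sqrt M * (1 - t * Num.sqrt c) ^+ n] by rewrite h2.
elim: n => [|n /and3P[s0 xs xr]]; first by rewrite /= subr0 lexx (ltW x0) expr0 mulr1.
have E1 : x - s n.+1 T = (x - s n T) * (1 - t * (x + s n T)) by rewrite /= x2; ring.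
have tx : t * (x + s n T) <= 1.
  by rewrite mulrC ler_pdivrMr // mul1r; lra.
apply/and3P; split.
- by rewrite /= addr_ge0 // mulr_ge0 ?(ltW t0) // x2 subr_sqr mulr_ge0 // addr_ge0 // ltW.
- by rewrite E1 mulr_ge0 // subr_ge0.
- rewrite E1 exprSr mulrA ler_pM ?(subr_ge0 (t * _)) //.
  by rewrite lerB // ler_wpM2l ?(ltW t0) //; lra.
Qed.

End Enveloping.

(** * The change of generators inside the algebra *)

Section RealizeLmx.
Variables (R : realType) (eps : R) (E : cstarAlgType R) (a1 a2 : E).
Hypothesis hE : is_wcar_enveloping eps a1 a2.
Hypothesis eps01 : 0 < eps < 1.
Local Notation C := R[i].
Local Notation param := (C * C * C)%type.
Local Notation rlz := (rlz eps a1 a2).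
Local Notation rlzR := (rlzR eps a1 a2).
Local Notation spec := (spec eps a1 a2).
Implicit Types (T : param).

Let eps0 : 0 < eps. Proof. by case/andP: eps01. Qed.

Definition rlzmx (M : param -> 'M[C]_4) : Prop := forall i j, rlz (fun T => M T i j).

Lemma rlzmx_mul M N : rlzmx M -> rlzmx N -> rlzmx (fun T => M T *m N T).
Proof.
move=> hM hN i j.
apply: (@rlz_ext _ _ _ _ _ (fun T => M T i (inord 0) * N T (inord 0) j +
  M T i (inord 1) * N T (inord 1) j + M T i (inord 2) * N T (inord 2) j +
  M T i (inord 3) * N T (inord 3) j)) => [T _|]; first by rewrite mxE sum4.
by do 3?apply: rlzD; apply: rlzM.
Qed.

Lemma rlzmx_mx4 (s : param -> seq (seq C)) :
  (forall i j, (i < 4)%N -> (j < 4)%N -> rlz (fun T => nth 0 (nth [::] (s T) i) j)) ->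
  rlzmx (fun T => mx4 (s T)).
Proof.
move=> h i j; apply: rlz_ext (h i j (ltn_ord i) (ltn_ord j)) => T _.
by rewrite mxE.
Qed.

Lemma rlzR_scoef (p : param -> R) (m : param -> C) (e : R) : 0 < e ->
  (forall T, spec T -> pre_chart e (p T) (m T)) -> rlzR p -> rlz m ->
  rlzR (fun T => scoef (p T) (m T)).
Proof.
move=> e0 pre hp hm; apply: (rlzR_sqrt hE (c := 4 * e)); first by rewrite mulr_gt0.
  by move=> T /pre; exact: pre_chart_s.
by apply: rlzRB; [exact: rlzRX | exact: rlzR_cabs2].
Qed.

Lemma scoef_ge e p m : 0 < e -> pre_chart e p m -> Num.sqrt (4 * e) <= scoef p m :> R.
Proof. by move=> e0 pre; apply: ler_wsqrtr; exact: pre_chart_s e0 pre. Qed.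

Lemma rlzR_scoef_inv (p : param -> R) (m : param -> C) (e : R) : 0 < e ->
  (forall T, spec T -> pre_chart e (p T) (m T)) -> rlzR p -> rlz m ->
  rlzR (fun T => (scoef (p T) (m T))^-1).
Proof.
move=> e0 pre hp hm; apply: (rlzR_inv hE (c := Num.sqrt (4 * e))).
- by rewrite sqrtr_gt0 mulr_gt0.
- by move=> T /pre; exact: (scoef_ge e0).
- exact: (rlzR_scoef e0).
Qed.

Lemma hroot_ge e (p : R) m : 0 < e -> pre_chart e p m -> 1 <= 2 * (p + scoef p m).
Proof.
move=> e0 pre; have s0 := scoef_gt0 e0 pre; have [/andP[p1 _] _] := pre.
lra.
Qed.

Lemma rlzR_hcoef_inv (p : param -> R) (m : param -> C) (e : R) : 0 < e ->
  (forall T, spec T -> pre_chart e (p T) (m T)) -> rlzR p -> rlz m ->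
  rlzR (fun T => (hcoef (p T) (m T))^-1).
Proof.
move=> e0 pre hp hm.
have hs := rlzR_scoef e0 pre hp hm; have hsi := rlzR_scoef_inv e0 pre hp hm.
have hr : rlzR (fun T => Num.sqrt (2 * (p T + scoef (p T) (m T)))).
  apply: (rlzR_sqrt hE (c := 1)) => //; first by move=> T /pre; exact: (hroot_ge e0).
  by apply: rlzRM; [exact: rlzR_cst | exact: rlzRD].
have hri : rlzR (fun T => (Num.sqrt (2 * (p T + scoef (p T) (m T))))^-1).
  apply: (rlzR_inv hE (c := 1)) hr => // T /pre pre'.
  by rewrite (le_trans _ (ler_wsqrtr (hroot_ge e0 pre'))) // sqrtr1.
apply: rlz_ext (rlzRM hsi hri) => T _.
by rewrite /hcoef invfM.
Qed.

Lemma rlzmx_frame (p : param -> R) (m N : param -> C) (e : R) : 0 < e ->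
  (forall T, spec T -> pre_chart e (p T) (m T)) -> rlzR p -> rlz m -> rlz N ->
  rlzmx (fun T => frame (p T) (m T) (N T)) /\ rlzmx (fun T => coframe (p T) (m T) (N T)).
Proof.
move=> e0 pre hp hm hN.
have hs := rlzR_scoef e0 pre hp hm.
have hsi : rlz (fun T => (scoef (p T) (m T))%:C^-1).
  by apply: rlz_ext (rlzR_scoef_inv e0 pre hp hm) => T _; rewrite fmorphV.
have hhi : rlz (fun T => (hcoef (p T) (m T))%:C^-1).
  by apply: rlz_ext (rlzR_hcoef_inv e0 pre hp hm) => T _; rewrite fmorphV.
have hmb := rlz_conj hm; have hNb := rlz_conj hN.
have h0 : rlz (fun=> 0) by exact: rlz_cst.
have h1 : rlz (fun=> 1) by exact: rlz_cst.
split; apply: rlzmx_mx4; case=> [|[|[|[|//]]]] [|[|[|[|//]]]] _ _ //=;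
  by do ?[apply: rlzM => //| apply: rlzD => // | apply: rlzN => //].
Qed.

Section Rescaled.
Variables (e' k l : R).
Hypotheses (e01' : 0 < e' < 1).
Hypotheses (kE : k ^+ 2 = (1 - e') / (1 - eps)).
Hypotheses (lE : l ^+ 2 = k ^+ 2 * (1 + eps) / (1 + e')).

Let e0' : 0 < e'. Proof. by case/andP: e01'. Qed.

(** The entries are assembled from alpha, delta and y in the order of their definitions; each
    inverse or root is taken of a function with a positive lower bound on the chart. *)
Lemma rlzmx_Lmx : rlzmx (Lmx k l).
Proof.
(* |y| is the square root of y y^*, which is at least eps^2. *)
have hY : rlzR (fun T => cabs T.2).
  apply: (rlz_ext (f := fun T => (Num.sqrt (cabs T.2 ^+ 2))%:C)).
    by move=> T _; rewrite sqrtr_sqr ger0_norm ?cabs_ge0.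
  apply: (rlzR_sqrt hE (c := eps ^+ 2)); first by rewrite exprn_gt0.
    move=> T /(spec_in_param eps01)[/andP[+ _] _ _ _]; rewrite /cp lerD2l => h.
    by rewrite ler_pXn2r ?nnegrE ?cabs_ge0 // ltW.
  exact: rlzR_cabs2 (rlz_y _ _ _).
have hYi : rlzR (fun T => (cabs T.2)^-1).
  apply: (rlzR_inv hE (c := eps)) hY => // T /(spec_in_param eps01)[/andP[+ _] _ _ _].
  by rewrite /cp lerD2l.
have hw : rlz (@cw R).
  apply: rlz_ext (rlzM (rlz_y _ _ _) hYi) => T _.
  by rewrite /cw fmorphV.
have hp : rlzR (@cp R) by apply: rlzRD hY; exact: rlzR_cst.
have hwal : rlz (fun T => (cw T)^* ^+ 2 * T.1.1).
  by apply: rlzM (rlz_al _ _ _); apply: rlzX; exact: rlz_conj.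
have hdb : rlz (fun T => (T.1.2)^*) by apply: rlz_conj; exact: rlz_de.
have hm : rlz (@cm R).
  by apply: rlzM; [exact: rlzD | exact: rlz_cst].
have hn : rlz (@cn R).
  by apply: rlzM; [exact: rlzB | exact: rlz_cst].
have pre T : spec T -> pre_chart eps (cp T) (cm T).
  by move=> /(spec_in_param eps01)/in_chart_pre.
have hN : rlz (@cN R).
  apply: rlz_ext (rlzM hn (rlzR_scoef_inv eps0 pre hp hm)) => T _.
  by rewrite /cN fmorphV.
have hg : rlzR (fun T => cabs (cN T) ^+ 2) by exact: rlzR_cabs2.
have hd : rlzR (fun T => dcoef (cp T) (cN T)).
  apply: rlzRB; first exact: rlzR_cst.
  by apply: rlzRM => //; apply: rlzRD => //; exact: rlzR_cst.
have hD : rlz (fun T => Dcoef (cm T) (cN T)).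
  by apply: rlzD => //; apply: rlzM; [exact: rlz_conj | exact: rlzX].
have hN' : rlz (fun T => rescale_N l (cN T)).
  by apply: rlzM => //; exact: rlz_cst.
have ch' T : spec T -> in_chart e' (rescale_p (k ^+ 2) l (cp T) (cN T))
    (rescale_m (k ^+ 2) l (cm T) (cN T)) (rescale_N l (cN T)).
  by move=> /(spec_in_param eps01); exact: in_chart_rescale.
have hp' : rlzR (fun T => rescale_p (k ^+ 2) l (cp T) (cN T)).
  have hl : rlzR (fun T => 1 + l ^+ 2 * cabs (cN T) ^+ 2).
    by apply: rlzRD; [|apply: rlzRM => //]; exact: rlzR_cst.
  apply: rlzRM; first by apply: rlzRB; [|apply: rlzRM => //]; exact: rlzR_cst.
  apply: (rlzR_inv hE (c := 1)) hl => // T _.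
  by rewrite lerDl mulr_ge0 ?sqr_ge0.
have hm' : rlz (fun T => rescale_m (k ^+ 2) l (cm T) (cN T)).
  apply: rlzM.
    apply: rlzM; first exact: rlz_cst.
    by apply: rlzB => //; apply: rlzM; [exact: rlzX | exact: rlz_conj].
  apply: (rlz_ext (f := fun T => ((1 - (l ^+ 2 * cabs (cN T) ^+ 2) ^+ 2)^-1)%:C)).
    by move=> T _; rewrite rescale_den fmorphV.
  (* The rescaled |N|^2 is at most 1 - e', so 1 - |N|^4 >= 1 - |N|^2 >= e'. *)
  apply: (rlzR_inv hE (c := e')) => //; last first.
    by apply: rlzRB; [|apply: rlzRX; apply: rlzRM => //]; exact: rlzR_cst.
  move=> T /ch'/(in_chart_N e0'); rewrite cabs_rescale_N.
  have : 0 <= l ^+ 2 * cabs (cN T) ^+ 2 by rewrite mulr_ge0 ?sqr_ge0.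
  have := e0'; move: (l ^+ 2 * _) => g e'0 g0 g1.
  have : g ^+ 2 <= g by rewrite expr2 ler_piMr //; lra.
  by lra.
have pre' T : spec T -> pre_chart e' (rescale_p (k ^+ 2) l (cp T) (cN T))
    (rescale_m (k ^+ 2) l (cm T) (cN T)) by move=> /ch'/in_chart_pre.
have [hF _] := rlzmx_frame eps0 pre hp hm hN.
have [_ hB] := rlzmx_frame e0' pre' hp' hm' hN'.
have hwb := rlz_conj hw.
have h0 : rlz (fun=> 0) by exact: rlz_cst.
have h1 : rlz (fun=> 1) by exact: rlz_cst.
have hK : rlzmx (fun T => mxK (cw T) (cw T)^*).
  apply: rlzmx_mx4; case=> [|[|[|[|//]]]] [|[|[|[|//]]]] _ _ //=; exact: rlz_cst.
have hKi : rlzmx (fun T => mxKinv (cw T) (cw T)^*).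
  apply: rlzmx_mx4; case=> [|[|[|[|//]]]] [|[|[|[|//]]]] _ _ //=;
  by [exact: rlz_cst | apply: rlzM => //; exact: rlz_cst].
have hS : rlzmx (fun=> mxS k%:C) by move=> i j; exact: rlz_cst.
exact (rlzmx_mul hKi (rlzmx_mul hB (rlzmx_mul hS (rlzmx_mul hF hK)))).
Qed.

Definition gens (i : 'I_4) : E := nth 0 [:: a1; star a2; star a1; a2] i.

(** The matrix entries vary with the representation, but their realizers do not; combining realizers
    with generators gives one family b valid in all representations. *)
Lemma rescaled_generators : exists b : 'I_4 -> E,
  forall (H : hilbertType R) (pi : E -> {linear H -> H}) T,
    env_irrep eps a1 a2 pi -> is_param T (pi a1) (pi a2) ->
    forall i v, pi (b i) v =
      mact (Lmx k l T) (ops4 (pi a1) (pi (star a2)) (pi (star a1)) (pi a2)) i v.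
Proof.
have /choice[z hz] : forall ij : 'I_4 * 'I_4, exists z : E,
    forall (H : hilbertType R) (pi : E -> {linear H -> H}) T,
    env_irrep eps a1 a2 pi -> is_param T (pi a1) (pi a2) ->
    forall v, pi z v = Lmx k l T ij.1 ij.2 *: v.
  by move=> [i j]; exact: rlzmx_Lmx.
exists (fun i => \sum_j z (i, j) * gens j) => H pi T irr hT i v.
have rep := irr.1.
have pi0 : pi 0 v = 0 by rewrite -(scale0r (0 : E)) rep_scale // scale0r.
rewrite (big_morph (fun x => pi x v) (fun x y => rep_add rep x y v) pi0).
apply: eq_bigr => j _; rewrite rep_mul // (hz (i, j) _ _ _ irr hT); congr (_ *: _).
by case: j => [[|[|[|[|//]]]] hj].
Qed.

End Rescaled.
End RealizeLmx.

(** * The isomorphism *)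

Section Graph.
Variables (R : realType) (e1 e2 : R) (E F : cstarAlgType R).
Variables (a1 a2 : E) (b1 b2 : F).
Hypotheses (hE : is_wcar_enveloping e1 a1 a2) (hF : is_wcar_enveloping e2 b1 b2).
Variable matched : forall H : hilbertType R,
  (E -> {linear H -> H}) -> (F -> {linear H -> H}) -> Prop.
Hypothesis matched_l : forall (H : hilbertType R) (pi : E -> {linear H -> H}) rho,
  matched pi rho -> env_irrep e1 a1 a2 pi.
Hypothesis matched_r : forall (H : hilbertType R) (pi : E -> {linear H -> H}) rho,
  matched pi rho -> env_irrep e2 b1 b2 rho.
Hypothesis total_l : forall (H : hilbertType R) (pi : E -> {linear H -> H}),
  env_irrep e1 a1 a2 pi -> exists rho, matched pi rho.
Hypothesis total_r : forall (H : hilbertType R) (rho : F -> {linear H -> H}),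
  env_irrep e2 b1 b2 rho -> exists pi : E -> {linear H -> H}, matched pi rho.

(** The isomorphism is first a relation: agreement in all matched pairs. That it is a bijective
    function follows from norms alone. *)
Definition graph (x : E) (z : F) : Prop :=
  forall (H : hilbertType R) (pi : E -> {linear H -> H}) rho,
    matched pi rho -> forall v, pi x v = rho z v.

(** Every representation in either family occurs in a matched pair, so both norms are suprema of the
    same operator norms. *)
Lemma graph_nrm x z : graph x z -> nrm x = nrm z.
Proof.
move=> xz; apply/eqP; rewrite eq_le; apply/andP; split.
- apply: (env_norm_le hE) => H pi v irr v1.
  have [rho m] := total_l irr; rewrite (xz _ _ _ m).
  apply: le_trans (env_irrep_le hF _ _ (matched_r m)) _.
  by rewrite ler_piMr ?nrm_ge0.
- apply: (env_norm_le hF) => H rho v irr v1.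
  have [pi m] := total_r irr; rewrite -(xz _ _ _ m).
  apply: le_trans (env_irrep_le hE _ _ (matched_l m)) _.
  by rewrite ler_piMr ?nrm_ge0.
Qed.

Lemma graphD x y z t : graph x z -> graph y t -> graph (x + y) (z + t).
Proof.
move=> h h' H pi rho m v; rewrite (rep_add (matched_l m).1) (rep_add (matched_r m).1).
by rewrite (h _ _ _ m) (h' _ _ _ m).
Qed.

Lemma graphZ (c : R[i]) x z : graph x z -> graph (c *: x) (c *: z).
Proof.
move=> h H pi rho m v; rewrite (rep_scale (matched_l m).1) (rep_scale (matched_r m).1).
by rewrite (h _ _ _ m).
Qed.

Lemma graphB x y z t : graph x z -> graph y t -> graph (x - y) (z - t).
Proof.
by move=> h h'; rewrite -[- y]scaleN1r -[- t]scaleN1r; apply: graphD h (graphZ _ h').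
Qed.

Lemma graphM x y z t : graph x z -> graph y t -> graph (x * y) (z * t).
Proof.
move=> h h' H pi rho m v; rewrite (rep_mul (matched_l m).1) (rep_mul (matched_r m).1).
by rewrite (h _ _ _ m) (h' _ _ _ m).
Qed.

Lemma graph1 : graph 1 1.
Proof. by move=> H pi rho m v; rewrite (rep_one (matched_l m).1) (rep_one (matched_r m).1). Qed.

Lemma graph_star x z : graph x z -> graph (star x) (star z).
Proof.
move=> h H pi rho m; apply: (adjoint_uniq (rep_star (matched_l m).1 x)) => u v.
by rewrite (h _ _ _ m) (rep_star (matched_r m).1).
Qed.

Lemma graph_uniq x z t : graph x z -> graph x t -> z = t.
Proof.
move=> h h'; apply/eqP; rewrite -subr_eq0 -nrm_eq0 -(graph_nrm (graphB h h')) subrr.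
by rewrite nrm0.
Qed.

Lemma graph_uniq_l x y z : graph x z -> graph y z -> x = y.
Proof.
move=> h h'; apply/eqP; rewrite -subr_eq0 -nrm_eq0 (graph_nrm (graphB h h')) subrr.
by rewrite nrm0.
Qed.

(** Partners of a convergent sequence form a Cauchy sequence by [graph_nrm], and their limit is a
    partner of the limit. *)
Lemma graph_dom_closed : closed [set x | exists z, graph x z].
Proof.
move=> x cx.
have d0 n : 0 < (2^-1 : R) ^+ n by rewrite exprn_gt0 ?invr_gt0.
have /choice[p hp] : forall n : nat, exists p : E * F,
    graph p.1 p.2 /\ nrm (x - p.1) < 2^-1 ^+ n.
  move=> n; have [|y [[z yz] xy]] := cx (ball x (2^-1 ^+ n)%:C).
    by apply: nbhsx_ballx; rewrite ltcR.
  exists (y, z); split=> //=.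
  by move: xy; rewrite -ball_normE /= nrmE ltcR.
(* Increments are below 2^-n + 2^-(n+1); those of the majorant are 2^(1-n). *)
have [||l hl] := @nrm_telescope_cvg R F (fun n => (p n).2) (fun n => 4 * (1 - 2^-1 ^+ n)) 4.
- move=> n; rewrite -(graph_nrm (graphB (hp n.+1).1 (hp n).1)).
  have := nrmB (p n.+1).1 x (p n).1; rewrite (nrmC _ x).
  have := (hp n).2; have := (hp n.+1).2; have := d0 n; rewrite exprS; lra.
- by move=> n; have := d0 n; lra.
exists l => H pi rho m v; apply/eqP; rewrite -subr_eq0; apply/eqP.
apply: nrm_small => e e0.
have K0 : 0 < 2 * (nrm v + 1) by rewrite mulr_gt0 // ltr_wpDl ?nrm_ge0.
have c0 := divr_gt0 e0 K0.
have /cvg_nrmP/(_ _ c0)[n0 hn0] := hl.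
have [n1 hn1] : exists n1, forall n, (n1 <= n)%N -> (2^-1 : R) ^+ n < e / (2 * (nrm v + 1)).
  have : (fun n => (2^-1 : R) ^+ n) @ \oo --> (0 : R).
    by apply: cvg_expr; rewrite ger0_norm ?invr_ge0 // invf_lt1 // ltr1n.
  move=> /cvgrPdist_lt/(_ _ c0)[n1 _ h]; exists n1 => n /h /=.
  by rewrite sub0r normrN ger0_norm // ltW.
have [h0 h1] := (hn0 _ (leq_maxl n0 n1), hn1 _ (leq_maxr n0 n1)).
set n := maxn n0 n1 in h0 h1.
have [pn xn] := hp n.
have A := env_irrep_le hE (x - (p n).1) v (matched_l m).
have B := env_irrep_le hF ((p n).2 - l) v (matched_r m).
rewrite (rep_sub _ _ _ (matched_l m).1) in A.
rewrite (rep_sub _ _ _ (matched_r m).1) in B.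
rewrite (pn _ _ _ m) in A.
have := nrmB (pi x v) (rho (p n).2 v) (rho l v).
have xn' := lt_trans xn h1.
move: h0 xn'; rewrite !ltr_pdivlMr // => h0 h2.
have := nrm_ge0 v; have := nrm_ge0 ((p n).2 - l); have := nrm_ge0 (x - (p n).1).
move: (nrm (x - _)) (nrm ((p n).2 - l)) (nrm v) A B h0 h2 => r q t; lra.
Qed.

(** The domain is a closed unital star-subalgebra containing the generators. *)
Lemma graph_dom (c1 c2 : F) : graph a1 c1 -> graph a2 c2 -> forall x, exists z, graph x z.
Proof.
move=> h1 h2 x.
suff : [set x | exists z, graph x z] = setT by move/seteqP => [_ /(_ x)]; apply.
apply: (env_generated hE graph_dom_closed).
- by move=> _ [->|->]; [exists c1|exists c2].
- by exists 1; exact: graph1.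
- by move=> y y' [z h] [z' h']; exists (z + z'); exact: graphD.
- by move=> c y [z h]; exists (c *: z); exact: graphZ.
- by move=> y y' [z h] [z' h']; exists (z * z'); exact: graphM.
- by move=> y [z h]; exists (star z); exact: graph_star.
Qed.

Lemma graph_isomorphic : (forall x, exists z, graph x z) -> (forall z, exists x, graph x z) ->
  cstar_isomorphic E F.
Proof.
move=> /choice[f hf] /choice[g hg].
have flin : linear f.
  move=> c x y; apply: graph_uniq (hf _) _.
  by apply: graphD (hf y); exact: graphZ.
have f1 : f 1 = 1 by apply: graph_uniq (hf _) graph1.
have fM : {morph f : x y / x * y}.
  by move=> x y; apply: graph_uniq (hf _) _; exact: graphM.
pose f' : {lrmorphism E -> F} := HB.pack f (GRing.isLinear.Build _ _ _ _ _ flin)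
  (GRing.isMonoidMorphism.Build _ _ _ (conj f1 fM)).
exists f'; split.
  exists g => x /=; first exact: graph_uniq_l (hg _) (hf _).
  exact: graph_uniq (hf _) (hg _).
by move=> x /=; apply: graph_uniq (hf _) _; exact: graph_star.
Qed.

End Graph.

(** * Matching the representations of the two algebras *)

Section Matching.
Variable R : realType.

Definition rescaled_gens (e : R) (E : cstarAlgType R) (a1 a2 : E) (k l : R) (b : 'I_4 -> E) :=
  forall (H : hilbertType R) (pi : E -> {linear H -> H}) T,
    env_irrep e a1 a2 pi -> is_param T (pi a1) (pi a2) ->
    forall i v, pi (b i) v =
      mact (Lmx k l T) (ops4 (pi a1) (pi (star a2)) (pi (star a1)) (pi a2)) i v.

(** Both directions are recorded, which makes the relation symmetric in the two algebras and puts
    the generators of each into the domain of the graph. *)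
Definition matched (e1 e2 : R) (E F : cstarAlgType R) (a1 a2 : E) (b1 b2 : F)
    (b : 'I_4 -> E) (a : 'I_4 -> F) (H : hilbertType R)
    (pi : E -> {linear H -> H}) (rho : F -> {linear H -> H}) : Prop :=
  [/\ env_irrep e1 a1 a2 pi, env_irrep e2 b1 b2 rho,
      (rho b1 =1 pi (b (inord 0))) /\ (rho b2 =1 pi (b (inord 3))) &
      (pi a1 =1 rho (a (inord 0))) /\ (pi a2 =1 rho (a (inord 3)))].

(** The images under pi of b 0 and b 3 form an irreducible representation for e2, which the
    universal property extends to rho. The inverse matrix at the rescaled parameter then recovers pi
    on a1 and a2. *)
Lemma matched_total (e1 e2 k l : R) (E F : cstarAlgType R) (a1 a2 : E) (b1 b2 : F)
    (b : 'I_4 -> E) (a : 'I_4 -> F) (H : hilbertType R) (pi : E -> {linear H -> H}) :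
  0 < e1 < 1 -> 0 < e2 < 1 -> 0 < k -> 0 < l ->
  k ^+ 2 = (1 - e2) / (1 - e1) -> l ^+ 2 = k ^+ 2 * (1 + e1) / (1 + e2) ->
  is_wcar_enveloping e2 b1 b2 ->
  rescaled_gens e1 a1 a2 k l b -> rescaled_gens e2 b1 b2 k^-1 l^-1 a ->
  env_irrep e1 a1 a2 pi -> exists rho, matched e1 e2 a1 a2 b1 b2 b a pi rho.
Proof.
move=> e10 e20 k0 l0 kE lE hF hb ha irr.
have [T hT] := is_param_exists irr.2.
have [rep wirr] := irr; have [wrep _ _] := wirr.
have pib := hb _ _ _ irr hT.
have madj := mact_adj (tau_real_Lmx k l T) (ops4_adj wrep).
(* This is needed twice: for the operators pi (b i), to obtain rho, and for rho b1, rho b2 with the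
   adjoints supplied by rho. Uniqueness of adjoints identifies the two remaining entries. *)
have key (B1 B2 Z1 Z2 : {linear H -> H}) : adjoint_of B1 Z1 -> adjoint_of B2 Z2 ->
    B1 =1 pi (b (inord 0)) -> B2 =1 pi (b (inord 3)) ->
    forall i, ops4 B1 Z2 Z1 B2 i =1
      mact (Lmx k l T) (ops4 (pi a1) (pi (star a2)) (pi (star a1)) (pi a2)) i.
  move=> adj1 adj2 hB1 hB2 i.
  have E0 : Z1 =1 mact (Lmx k l T) (ops4 (pi a1) (pi (star a2)) (pi (star a1)) (pi a2)) (inord 2).
    apply: (adjoint_uniq adj1) => u v; rewrite hB1 pib.
    by have := madj (inord 0) u v; rewrite tau_inord.
  have E1 : Z2 =1 mact (Lmx k l T) (ops4 (pi a1) (pi (star a2)) (pi (star a1)) (pi a2)) (inord 1).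
    apply: (adjoint_uniq adj2) => u v; rewrite hB2 pib.
    by have := madj (inord 3) u v; rewrite tau_inord.
  have iE : i = inord i by rewrite inord_val.
  move=> v; case: i iE => [[|[|[|[|//]]]] hi] /= -> /=; rewrite /ops4 !inordK //=.
  - by rewrite hB1 pib.
  - by rewrite hB2 pib.
have K1 := key _ _ _ _ (rep_star rep (b (inord 0))) (rep_star rep (b (inord 3)))
  (fun=> erefl) (fun=> erefl).
have irr' := rescaled_irrep e10 e20 k0 l0 kE lE wirr hT
  (rep_cont rep (x := b (inord 0))) (rep_cont rep (x := b (inord 3))) K1.
have [rho [rrep r1 r2]] := env_extend hF irr'.
have K2 := key _ _ _ _ (rep_star rrep b1) (rep_star rrep b2) r1 r2.
have rirr : env_irrep e2 b1 b2 rho.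
  split=> //; exact: (rescaled_irrep e10 e20 k0 l0 kE lE wirr hT
    (rep_cont rrep (x := b1)) (rep_cont rrep (x := b2)) K2).
have hT' := rescaled_is_param e10 e20 kE lE wirr hT K2.
have back := rescaled_back e10 e20 k0 l0 kE lE wirr hT K2.
exists rho; split=> //; split=> v; rewrite (ha _ _ _ rirr hT') back /ops4 inordK //.
Qed.

End Matching.

Theorem proposition3p6 (R : realType) (eps1 eps2 : R)
    (heps1 : 0 < eps1 < 1) (heps2 : 0 < eps2 < 1)
    (E1 E2 : cstarAlgType R) (a1 a2 : E1) (b1 b2 : E2)
    (hE1 : is_wcar_enveloping eps1 a1 a2)
    (hE2 : is_wcar_enveloping eps2 b1 b2) :
  cstar_isomorphic E1 E2.
Proof.
have [/andP[e0 e1] /andP[e0' e1']] := (heps1, heps2).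
(* The squares of k and l are the constants of [in_chart_rescale]; their inverses satisfy the same
   equations with eps1 and eps2 exchanged. *)
pose k := Num.sqrt ((1 - eps2) / (1 - eps1)).
pose l := Num.sqrt (k ^+ 2 * (1 + eps1) / (1 + eps2)).
have k0' : 0 < (1 - eps2) / (1 - eps1) by rewrite divr_gt0 // subr_gt0.
have k0 : 0 < k by rewrite sqrtr_gt0.
have kE : k ^+ 2 = (1 - eps2) / (1 - eps1) by rewrite sqr_sqrtr // ltW.
have l0' : 0 < k ^+ 2 * (1 + eps1) / (1 + eps2).
  by rewrite divr_gt0 ?mulr_gt0 ?exprn_gt0 ?addr_gt0.
have l0 : 0 < l by rewrite sqrtr_gt0.
have lE : l ^+ 2 = k ^+ 2 * (1 + eps1) / (1 + eps2) by rewrite sqr_sqrtr // ltW.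
have d1 : 1 - eps1 != 0 by rewrite subr_eq0 gt_eqF.
have d2 : 1 - eps2 != 0 by rewrite subr_eq0 gt_eqF.
have s1 : 1 + eps1 != 0 by rewrite gt_eqF // addr_gt0.
have s2 : 1 + eps2 != 0 by rewrite gt_eqF // addr_gt0.
have kE' : k^-1 ^+ 2 = (1 - eps1) / (1 - eps2) by rewrite exprVn kE invf_div.
have lE' : l^-1 ^+ 2 = k^-1 ^+ 2 * (1 + eps2) / (1 + eps1).
  by rewrite kE' exprVn lE kE; field; rewrite d1 d2 s1 s2.
have [b hb] := rescaled_generators hE1 heps1 heps2 kE lE.
have [a ha] := rescaled_generators hE2 heps2 heps1 kE' lE'.
pose M := @matched R eps1 eps2 E1 E2 a1 a2 b1 b2 b a.
pose M' := fun (H : hilbertType R) rho pi => M H pi rho.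
have Ml H pi rho : M H pi rho -> env_irrep eps1 a1 a2 pi by case.
have Mr H pi rho : M H pi rho -> env_irrep eps2 b1 b2 rho by case.
have Tl H pi : env_irrep eps1 a1 a2 pi -> exists rho, M H pi rho.
  exact: (matched_total heps1 heps2 k0 l0 kE lE hE2 hb ha).
(* Totality on the right is totality on the left with the algebras exchanged and the constants
   inverted. *)
have Tr H rho : env_irrep eps2 b1 b2 rho -> exists pi, M H pi rho.
  have k0i : 0 < k^-1 by rewrite invr_gt0.
  have l0i : 0 < l^-1 by rewrite invr_gt0.
  move=> irr; have hb' : rescaled_gens eps1 a1 a2 k^-1^-1 l^-1^-1 b by rewrite !invrK.
  have [pi [? ? ? ?]] := matched_total heps2 heps1 k0i l0i kE' lE' hE1 ha hb' irr.
  by exists pi.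
apply: (graph_isomorphic hE1 hE2 Ml Mr Tl Tr).
- by apply: (graph_dom hE1 hE2 Ml Mr Tl Tr) => H pi rho [_ _ _ [h h']]; [exact: h|exact: h'].
(* Surjectivity is totality of the graph for the flipped matching M'. *)
- move=> z; have [x hx] : exists x, graph M' z x.
    apply: (graph_dom hE2 hE1 (matched := M') (fun H pi rho => Mr H rho pi)
      (fun H pi rho => Ml H rho pi) Tr Tl) => H rho pi [_ _ [h h'] _]; [exact: h|exact: h'].
  by exists x => H pi rho m v; rewrite -(hx _ _ _ m).
Qed.
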